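(* Let $\lambda\in(0,1)$ and let $\Pi$ be a strongly $\lambda$-extendible property on a graph class $\mathcal{G}$. If $\lambda\neq\frac{1}{2}$ or $K_3\in\Pi$, then APT($\Pi$) has a kernel with $\mathcal{O}(k^2)$ vertices.
   Context: $\mathcal{G}$ is a class of graphs whose edges may carry orientations and/or labels from a finite set. For $G\in\mathcal{G}$, $U(G)$ denotes the underlying simple graph; subgraphs inherit orientations/labels. A graph property $\Pi$ is a subset of $\mathcal{G}$ closed under isomorphism; ''$K_3\in\Pi$'' means every $G\in\mathcal{G}$ with $U(G)=K_3$ belongs to $\Pi$. For $\lambda\in(0,1)$, $\Pi$ is strongly $\lambda$-extendible if: (inclusiveness) every $G\in\mathcal{G}$ with $U(G)\in\{K_1,K_2\}$ is in $\Pi$; (block additivity) $G\in\Pi$ iff every block of $G$ is in $\Pi$; (strong $\lambda$-subgraph extension) for every $G\in\mathcal{G}$ and every partition $(U,W)$ of $V(G)$ with $G[U],G[W]\in\Pi$, there is a set $F$ of edges between $U$ and $W$ with $|F|\geq\lambda|E(U,W)|$ such that $G-(E(U,W)\setminus F)\in\Pi$. The problem APT($\Pi$) (above Poljak–Turzík): given a connected graph $G\in\mathcal{G}$ and a parameter $k$, decide whether $G$ has a subgraph belonging to $\Pi$ with at least $\lambda|E(G)|+\frac{1-\lambda}{2}(|V(G)|-1)+k$ edges. A kernel with $f(k)$ vertices is a polynomial-time algorithm that transforms any instance $(G,k)$ into an equivalent instance $(G',k')$ with $k'\leq k$ and $|V(G')|\leq f(k)$.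
   Formalization: The graph class is assumed to be closed under isomorphism and under taking subgraphs (with inherited orientations and labels); for an arbitrary class, such as K_1, K_2 and long cycles only, the claim fails. *)

(* Defs.v *)
From HB Require Import structures.
From mathcomp Require Import all_boot all_order all_algebra reals.

Set Implicit Arguments.
Unset Strict Implicit.
Unset Printing Implicit Defensive.

Import Order.TTheory GRing.Theory Num.Theory.
Local Open Scope ring_scope.
Local Obligation Tactic := idtac.

(* A finite simple graph in which every edge may carry an orientation and/or  *)
(* a label from L.  [ori G x y] means that the edge xy is oriented from x to  *)
(* y; an unoriented edge has [ori G x y = ori G y x = false], an unlabelled   *)
(* one has [lab G x y = None].  Non-edges are forced to carry neither.        *)
Record lgraph (L V : finType) := LGraph {
  adj : rel V;
  ori : rel V;
  lab : V -> V -> option L;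
  adj_sym : symmetric adj;
  adj_irr : irreflexive adj;
  ori_adj : forall x y, ori x y -> adj x y;
  ori_anti : forall x y, ori x y -> ~~ ori y x;
  lab_sym : forall x y, lab x y = lab y x;
  lab_adj : forall x y, lab x y -> adj x y }.

Definition graph_family (L : finType) := forall V : finType, lgraph L V -> Prop.

Section Graphs.
Variable L : finType.
Implicit Types V W : finType.

Definition iso V W (G : lgraph L V) (H : lgraph L W) : Prop :=
  exists2 f : V -> W, bijective f &
    forall x y, [/\ adj G x y = adj H (f x) (f y),
                    ori G x y = ori H (f x) (f y) &
                    lab G x y = lab H (f x) (f y)].

(* H is (isomorphic to) a subgraph of G, not necessarily spanning or induced, *)
(* with the orientations and labels inherited from G.                         *)
Definition subgraph W V (H : lgraph L W) (G : lgraph L V) : Prop :=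
  exists2 f : W -> V, injective f &
    forall x y, adj H x y -> [/\ adj G (f x) (f y),
                                 ori H x y = ori G (f x) (f y) &
                                 lab H x y = lab G (f x) (f y)].

Program Definition underlying V (G : lgraph L V) : lgraph L V :=
  @LGraph L V (adj G) (fun _ _ => false) (fun _ _ => None) _ _ _ _ _ _.
Next Obligation. by move=> V G; exact: adj_sym. Qed.
Next Obligation. by move=> V G; exact: adj_irr. Qed.
Next Obligation. by []. Qed.
Next Obligation. by []. Qed.
Next Obligation. by []. Qed.
Next Obligation. by []. Qed.

Program Definition complete (n : nat) : lgraph L 'I_n :=
  @LGraph L 'I_n (fun x y => x != y) (fun _ _ => false) (fun _ _ => None)
    _ _ _ _ _ _.
Next Obligation. by move=> n x y; rewrite eq_sym. Qed.
Next Obligation. by move=> n x; rewrite eqxx. Qed.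
Next Obligation. by []. Qed.
Next Obligation. by []. Qed.
Next Obligation. by []. Qed.
Next Obligation. by []. Qed.

Program Definition induced V (G : lgraph L V) (U : {set V}) :
    lgraph L {x : V | x \in U} :=
  @LGraph L {x : V | x \in U}
    (fun x y => adj G (val x) (val y)) (fun x y => ori G (val x) (val y))
    (fun x y => lab G (val x) (val y)) _ _ _ _ _ _.
Next Obligation. by move=> V G U x y; exact: adj_sym. Qed.
Next Obligation. by move=> V G U x; exact: adj_irr. Qed.
Next Obligation. by move=> V G U x y; exact: ori_adj. Qed.
Next Obligation. by move=> V G U x y; exact: ori_anti. Qed.
Next Obligation. by move=> V G U x y; exact: lab_sym. Qed.
Next Obligation. by move=> V G U x y; exact: lab_adj. Qed.

(* E(U, W); edges are two-element vertex sets. *)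
Definition edges_between V (G : lgraph L V) (U W : {set V}) : {set {set V}} :=
  [set [set x; y] | x in U, y in W & adj G x y].

Definition edges V (G : lgraph L V) : {set {set V}} := edges_between G setT setT.

Program Definition del_edges V (G : lgraph L V) (D : {set {set V}}) :
    lgraph L V :=
  @LGraph L V (fun x y => adj G x y && ([set x; y] \notin D))
    (fun x y => ori G x y && ([set x; y] \notin D))
    (fun x y => if [set x; y] \notin D then lab G x y else None) _ _ _ _ _ _.
Next Obligation. by move=> V G D x y /=; rewrite adj_sym setUC. Qed.
Next Obligation. by move=> V G D x /=; rewrite adj_irr. Qed.
Next Obligation. by move=> V G D x y /andP[/ori_adj -> ->]. Qed.
Next Obligation. by move=> V G D x y /andP[/ori_anti/negPf -> _]. Qed.
Next Obligation. by move=> V G D x y /=; rewrite setUC lab_sym. Qed.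
Next Obligation. by move=> V G D x y /=; case: ifP => // _ /lab_adj ->. Qed.

Definition connected V (G : lgraph L V) : Prop :=
  (0 < #|V|)%N /\ forall x y, connect (adj G) x y.

Definition ncomponents V (G : lgraph L V) : nat := n_comp (adj G) V.

Definition cut_vertex V (G : lgraph L V) (v : V) : Prop :=
  (ncomponents G < ncomponents (induced G (~: [set v])))%N.

Definition nonseparable V (G : lgraph L V) : Prop :=
  connected G /\ forall v, ~ cut_vertex G v.

(* A block is a maximal connected subgraph that has no cut vertex of its own; *)
(* such a subgraph is induced, hence given by its vertex set B.               *)
Definition block V (G : lgraph L V) (B : {set V}) : Prop :=
  nonseparable (induced G B) /\
  forall B' : {set V}, B \subset B' -> nonseparable (induced G B') -> B' = B.

(* In particular closed under isomorphism. *)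
Definition subgraph_closed (GG : graph_family L) : Prop :=
  forall V W (G : lgraph L V) (H : lgraph L W),
    subgraph H G -> GG V G -> GG W H.

Definition graph_property (GG Pi : graph_family L) : Prop :=
  (forall V (G : lgraph L V), Pi V G -> GG V G) /\
  (forall V W (G : lgraph L V) (H : lgraph L W), iso G H -> Pi V G -> Pi W H).

(* K_n \in Pi *)
Definition contains_K (n : nat) (GG Pi : graph_family L) : Prop :=
  forall V (G : lgraph L V), GG V G -> iso (underlying G) (complete n) -> Pi V G.

Definition inclusive (GG Pi : graph_family L) : Prop :=
  contains_K 1 GG Pi /\ contains_K 2 GG Pi.

Definition block_additive (GG Pi : graph_family L) : Prop :=
  forall V (G : lgraph L V), GG V G ->
    (Pi V G <-> forall B, block G B -> Pi _ (induced G B)).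

Definition strong_subgraph_extension (R : realType) (lam : R)
    (GG Pi : graph_family L) : Prop :=
  forall V (G : lgraph L V) (U W : {set V}), GG V G ->
    U :|: W = setT -> [disjoint U & W] ->
    Pi _ (induced G U) -> Pi _ (induced G W) ->
    exists F : {set {set V}},
      [/\ F \subset edges_between G U W,
          lam * #|edges_between G U W|%:R <= #|F|%:R &
          Pi V (del_edges G (edges_between G U W :\: F))].

Definition strongly_extendible (R : realType) (lam : R)
    (GG Pi : graph_family L) : Prop :=
  [/\ inclusive GG Pi, block_additive GG Pi &
      strong_subgraph_extension lam GG Pi].

Definition APT_instance (GG : graph_family L) V (G : lgraph L V) : Prop :=
  GG V G /\ connected G.

Definition APT_yes (R : realType) (lam : R) (Pi : graph_family L)
    V (G : lgraph L V) (k : nat) : Prop :=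
  exists (W : finType) (H : lgraph L W),
    [/\ subgraph H G, Pi W H &
        lam * #|edges G|%:R + (1 - lam) / 2 * (#|V|%:R - 1) + k%:R
          <= #|edges H|%:R].

End Graphs.

(* Deterministic multi-tape Turing machines with one-way infinite tapes over  *)
(* an input/output alphabet A extended by work symbols and a blank (None).    *)
(* Tape 0 holds the input at the start and the output at the end.             *)
Inductive move := MoveLeft | Stay | MoveRight.

Record tm (A : finType) := TM {
  tapes : nat;  (* the machine has tapes.+1 tapes *)
  work : finType;
  state : finType;
  start : state;
  final : pred state;
  delta : state -> {ffun 'I_tapes.+1 -> option (A + work)} ->
          state * ('I_tapes.+1 -> option (A + work) * move) }.

Section Machines.
Variables (A : finType) (M : tm A).

Record config := Config {
  cstate : state M;
  chead : 'I_(tapes M).+1 -> nat;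
  ctape : 'I_(tapes M).+1 -> nat -> option (A + work M) }.

Definition move_head (m : move) (p : nat) : nat :=
  match m with MoveLeft => p.-1 | Stay => p | MoveRight => p.+1 end.

(* Final configurations are fixed points. *)
Definition step (c : config) : config :=
  if final (cstate c) then c else
  let: (q, act) := delta (cstate c) [ffun i => ctape c i (chead c i)] in
  Config q
    (fun i => move_head (act i).2 (chead c i))
    (fun i p => if p == chead c i then (act i).1 else ctape c i p).

Definition word_tape (w : seq A) (p : nat) : option (A + work M) :=
  nth None [seq Some (inl a) | a <- w] p.

Definition init_config (w : seq A) : config :=
  Config (start M) (fun=> 0%N)
    (fun i => if i == ord0 then word_tape w else fun=> None).

Definition computes_within (w : seq A) (t : nat) (w' : seq A) : Prop :=
  let c := iter t step (init_config w) in
  final (cstate c) /\ forall p, ctape c ord0 p = word_tape w' p.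

End Machines.

(* Encoding of (G, k): k in unary, then the rows of the adjacency matrix,     *)
(* each preceded by a separator; the entry at (i, j) records adjacency,       *)
(* orientation and label.                                                     *)
Definition alphabet (L : finType) : finType := (bool + bool * bool * option L)%type.

Definition tick (L : finType) : alphabet L := inl true.
Definition newrow (L : finType) : alphabet L := inl false.

Definition encode (L : finType) (n : nat) (G : lgraph L 'I_n) (k : nat) :
    seq (alphabet L) :=
  nseq k (tick L) ++
  flatten [seq newrow L ::
             [seq (inr (adj G i j, ori G i j, lab G i j) : alphabet L)
             | j <- enum 'I_n]
          | i <- enum 'I_n].

(* A kernel with f(k) vertices, for the parameterized problem whose instances *)
(* are the pairs (G, k) with [inst G].  The machine is only constrained on    *)
(* encodings of instances; its output is again the encoding of an instance.   *)
Definition has_kernel (L : finType)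
    (inst : forall n, lgraph L 'I_n -> Prop)
    (yes : forall n, lgraph L 'I_n -> nat -> Prop) (f : nat -> nat) : Prop :=
  exists (M : tm (alphabet L)) (a d : nat),
    forall n (G : lgraph L 'I_n) (k : nat), inst n G ->
    exists n' (G' : lgraph L 'I_n') (k' t : nat),
      [/\ computes_within M (encode G k) t (encode G' k'),
          (t <= a * size (encode G k) ^ d + a)%N,
          inst n' G' /\ (yes n G k <-> yes n' G' k'),
          (k' <= k)%N &
          (n' <= f k)%N].

Definition APT_has_kernel (R : realType) (lam : R) (L : finType)
    (GG Pi : graph_family L) (f : nat -> nat) : Prop :=
  has_kernel (fun n G => APT_instance GG G) (fun n G k => APT_yes lam Pi G k) f.

(* Main.v *)
Require Import Defs.
From mathcomp Require Import all_boot all_order all_algebra reals.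
From mathcomp Require Import boolp zify lra.

Set Implicit Arguments.
Unset Strict Implicit.
Unset Printing Implicit Defensive.

Import Order.TTheory GRing.Theory Num.Theory.

(* Write ex(G) for the maximum size of a subgraph of G in Pi minus the        *)
(* Poljak-Turzik bound.  The point is that ex(G) >= c (|V(G)| - 1) for every  *)
(* connected G, with c > 0 depending on lam only; so the answer is yes as     *)
(* soon as |V(G)| exceeds a linear function of k, and the kernelization just  *)
(* compares |V(G)| with that threshold and outputs either G or K_1.           *)
(*   Put mu(G) = ex(G) - (1 - lam)/2.  By strong extension, mu is             *)
(* superadditive for vertex partitions, with an additional rounding gain      *)
(* ceil(lam e) - lam e when e edges cross; by block additivity, gluing two    *)
(* graphs at a vertex adds their ex.  Hence it is enough to find, in a        *)
(* connected G with at least 4 vertices, a set Q such that G - Q is connected *)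
(* and mu(G[Q]), possibly with the rounding gain, is at least c |Q|.  Such Q  *)
(* are, for instance, induced paths on 3 vertices, and triangles when         *)
(* lam < 1/3, when lam > 1/2, or when lam = 1/2 and K_3 is in Pi.             *)
(*   To locate Q, take (r, S) with r in S, G[S] and G - S connected, r        *)
(* attached to G - S, |S| >= 4 and |S| minimal.  Every component of G[S] - r  *)
(* can be removed without disconnecting G and has, by minimality, at most 3   *)
(* vertices, which leaves few configurations to inspect.                      *)

(** An instance with at least (k + 1)(N + 1) vertices, where N eps >= 15, is a yes-instance because
    a connected graph exceeds the bound by at least eps / 15 per vertex beyond the first
    ([linear_surplus_conn], [APT_yes_surplus]). So the kernel is even linear in k, and [kmachine]
    computes it by counting matrix rows.

    Surplus comes from integrality: of e edges crossing a partition, strong extension keeps at least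
    ceil(lam e) ([surplus_join], [surplus_round]), and gluing at a vertex loses nothing
    ([surplus_glue]). One crossing edge gains 1 - lam, which makes an edge neutral and an induced
    path on three vertices profitable ([surplus2], [surplus_path]). The obstacle is the triangle:
    for 1/3 <= lam < 1/2 its guaranteed surplus (1 - 3 lam) / 2 is not positive, and the profit must
    come from the edges joining the removed set to the rest, since two such edges already gain 1 - 2
    lam. At lam = 1/2 rounding two edges gains nothing, and membership of K_3 takes over
    ([surplus_triangle_in]).

    In the induction ([linear_surplus_step]), [remove_rooted] inspects the components of S - r. A
    single component is a triangle attached to r. If some component can be joined to r at no loss,
    all of S is removed. Otherwise every component is an edge forming a triangle with r, and one
    removes either such an edge that is not attached outside S, or an induced path through r. *)

Local Open Scope nat_scope.

(** * The threshold machine *)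

Section ThresholdMachine.
Variables (L : finType) (N : nat).

Notation symb := (option (alphabet L + unit)).
Notation action := (symb * move)%type.

(** The state [inr i] records that i row separators were read since the counter was last
    decremented. *)
Definition kstate : finType := ((bool * bool * bool) + 'I_N.+1)%type.

Definition q_init : kstate := inl (true, true, true).
Definition q_count : kstate := inl (true, true, false).
Definition q_over : kstate := inl (true, false, true).
Definition q_erase : kstate := inl (true, false, false).
Definition q_write : kstate := inl (false, true, true).
Definition q_done : kstate := inl (false, true, false).
Definition q_row (i : nat) : kstate := inr (inord i).

Definition mark : symb := Some (inr tt).
Definition isolated_entry : alphabet L := inr (false, false, None).

(* Tape 1 is a counter and tape 2 follows the head of tape 0; both carry a    *)
(* mark at cell 0, which is how the left end of a tape is recognized.         *)
Definition kdelta (q : kstate) (s0 s1 s2 : symb) :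
    kstate * action * action * action :=
  match q with
  | inl (true, true, true) => (q_count, (s0, Stay), (mark, Stay), (mark, Stay))
  | inl (true, true, false) =>
    if s0 is Some (inl (inl true)) then
      (q_count, (s0, MoveRight), (s1, MoveRight), (s2, MoveRight))
    else (q_row 0, (s0, Stay), (s1, Stay), (s2, Stay))
  | inl (true, false, true) =>
    if s0 is None then (q_erase, (s0, MoveLeft), (s1, Stay), (s2, MoveLeft))
    else (q_over, (s0, MoveRight), (s1, Stay), (s2, MoveRight))
  | inl (true, false, false) =>
    if s2 is Some (inr tt) then
      (q_write, (Some (inl (newrow L)), MoveRight), (s1, Stay), (s2, Stay))
    else (q_erase, (None, MoveLeft), (s1, Stay), (s2, MoveLeft))
  | inl (false, true, true) =>
    (q_done, (Some (inl isolated_entry), Stay), (s1, Stay), (s2, Stay))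
  | inl _ => (q_done, (s0, Stay), (s1, Stay), (s2, Stay))
  | inr i =>
    match s0 with
    | None => (q_done, (s0, Stay), (s1, Stay), (s2, Stay))
    | Some (inl (inl false)) =>
      if i < N then
        (q_row i.+1, (s0, MoveRight), (s1, Stay), (s2, MoveRight))
      else if s1 is Some _ then
        (q_over, (s0, MoveRight), (s1, Stay), (s2, MoveRight))
      else (q_row 0, (s0, MoveRight), (s1, MoveLeft), (s2, MoveRight))
    | _ => (inr i, (s0, MoveRight), (s1, Stay), (s2, MoveRight))
    end
  end.

Definition on_tape T (x y z : T) (i : 'I_3) : T :=
  if val i == 0 then x else if val i == 1 then y else z.

Definition kmachine : tm (alphabet L) :=
  @TM (alphabet L) 2 unit kstate q_init (pred1 q_done)
    (fun q s => let: (q', x, y, z) :=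
       kdelta q (s ord0) (s (inord 1)) (s (inord 2)) in
       (q', on_tape x y z)).

Definition kconfig (q : kstate) (p0 p1 p2 : nat) (T0 T1 T2 : nat -> symb) :
    config kmachine :=
  @Config _ kmachine q (on_tape p0 p1 p2) (on_tape T0 T1 T2).

Definition upd (T : nat -> symb) (p : nat) (s : symb) : nat -> symb :=
  fun p' => if p' == p then s else T p'.

Lemma upd_id (T : nat -> symb) (p : nat) : upd T p (T p) = T.
Proof. by apply: funext => p'; rewrite /upd; case: eqP => // ->. Qed.

Lemma step_kconfig (q : kstate) (p0 p1 p2 : nat) (T0 T1 T2 : nat -> symb) :
  q != q_done ->
  step (kconfig q p0 p1 p2 T0 T1 T2) =
  let: (q', x, y, z) := kdelta q (T0 p0) (T1 p1) (T2 p2) in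
  kconfig q' (move_head x.2 p0) (move_head y.2 p1) (move_head z.2 p2)
    (upd T0 p0 x.1) (upd T1 p1 y.1) (upd T2 p2 z.1).
Proof.
move=> /negPf qF; rewrite /step /= qF !ffunE /on_tape /= !inordK //=.
case: (kdelta _ _ _ _) => [[[q' x] y] z]; rewrite /kconfig; congr Config.
  by apply: funext => -[[|[|[|i]]] ?].
by apply: funext => -[[|[|[|i]]] ?]; apply: funext => p.
Qed.

Definition marked : nat -> symb := fun p => if p == 0 then mark else None.

Lemma init_kconfig (w : seq (alphabet L)) :
  init_config kmachine w =
  kconfig q_init 0 0 0 (@word_tape _ kmachine w) (fun=> None) (fun=> None).
Proof.
rewrite /init_config /kconfig; congr Config.
  by apply: funext => -[[|[|[|i]]] ?].
by apply: funext => -[[|[|[|i]]] ?].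
Qed.

Lemma step_init (T : nat -> symb) :
  step (kconfig q_init 0 0 0 T (fun=> None) (fun=> None)) =
  kconfig q_count 0 0 0 T marked marked.
Proof. by rewrite step_kconfig //= upd_id. Qed.

Lemma iter_count (T : nat -> symb) (k : nat) :
  (forall p, p < k -> T p = Some (inl (tick L))) ->
  iter k (@step _ kmachine) (kconfig q_count 0 0 0 T marked marked) =
  kconfig q_count k k k T marked marked.
Proof.
elim: k => // k IH Tk; rewrite iterS IH => [|p pk]; last by apply: Tk; lia.
by rewrite step_kconfig //= Tk //= !upd_id -(Tk k) // upd_id.
Qed.

Lemma step_count (T : nat -> symb) (k : nat) :
  T k <> Some (inl (tick L)) ->
  step (kconfig q_count k k k T marked marked) =
  kconfig (q_row 0) k k k T marked marked.
Proof.
rewrite step_kconfig //= => Tk.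
case E: (T k) Tk => [[[[]|?]|?]|] // _;
  by rewrite /= !upd_id -E upd_id.
Qed.

Lemma iter_over (T : nat -> symb) (p a m : nat) :
  (forall i, i < m -> T (p + i) <> None) ->
  iter m (@step _ kmachine) (kconfig q_over p a p T marked marked) =
  kconfig q_over (p + m) a (p + m) T marked marked.
Proof.
elim: m => [|m IH] Tm; first by rewrite addn0.
rewrite iterS IH => [|i im]; last by apply: Tm; lia.
rewrite step_kconfig //=.
case E: (T (p + m)) (Tm m (ltnSn m)) => [s|] // _.
by rewrite /= !upd_id -E upd_id addnS.
Qed.

(** Cell 0 survives: there tape 2 shows the mark, and the next step writes [newrow] instead of a
    blank. *)
Lemma iter_erase (T : nat -> symb) (a p : nat) :
  iter p (@step _ kmachine) (kconfig q_erase p a p T marked marked) =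
  kconfig q_erase 0 a 0 (fun i => if 0 < i <= p then None else T i)
    marked marked.
Proof.
elim: p T => [|p IH] T.
  by rewrite /=; congr kconfig; apply: funext => -[].
rewrite iterSr step_kconfig //= !upd_id IH; congr kconfig.
apply: funext => i; rewrite /upd; case: (i =P p.+1) => [->|ne].
  by rewrite if_same leqnn.
by have -> : (0 < i <= p.+1) = (0 < i <= p) by lia.
Qed.

(* [b] counts the row separators that can still be read before the overflow.  *)
Lemma iter_row (T : nat -> symb) (s : seq (alphabet L)) (p a r : nat) :
  r <= N -> all (predC1 (tick L)) s ->
  (forall i, i < size s -> T (p + i) = Some (inl (nth (tick L) s i))) ->
  let b := a * N.+1 + (N - r) in
  exists q a', iter (size s) (@step _ kmachine)
      (kconfig (q_row r) p a p T marked marked) =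
    kconfig q (p + size s) a' (p + size s) T marked marked /\
    if count_mem (newrow L) s <= b then exists i, q = q_row i else q = q_over.
Proof.
elim: s p a r => [|x s IH] p a r rN /=.
  by move=> _ _; exists (q_row r), a; rewrite addn0; split=> //; exists r.
move=> /andP[xt st] Ts.
have Tp : T p = Some (inl x) by rewrite -[p]addn0 (Ts 0).
have Ts' i : i < size s -> T (p.+1 + i) = Some (inl (nth (tick L) s i)).
  by move=> si; rewrite addSnnS (Ts i.+1).
rewrite -iterS iterSr step_kconfig //= Tp addnS -addSn.
clear Ts; case: x xt Tp => [[//|]|e] _ Tp; last first.
  by rewrite /= !upd_id -Tp upd_id; have [q [a' H]] := IH p.+1 a r rN st Ts';
     exists q, a'.
rewrite /= inordK // add1n; case: (ltnP r N) => rN'.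
  rewrite /= !upd_id -Tp upd_id.
  have [q [a' [-> H]]] := IH p.+1 a r.+1 rN' st Ts'; exists q, a'; split=> //.
  move: H; have -> : (a * N.+1 + (N - r)) = (a * N.+1 + (N - r.+1)).+1 by lia.
  by rewrite ltnS.
(* At [a = 0] the head of tape 1 is on the mark: the counter is exhausted and the rest of the input
   is skipped. *)
case: a => [|a] /=.
  rewrite !upd_id -Tp upd_id iter_over => [|i /Ts' ->//].
  exists q_over, 0; split=> //.
  by have -> : N - r = 0 by lia.
rewrite !upd_id -Tp upd_id.
have [q [a' [-> H]]] := IH p.+1 a 0 isT st Ts'; exists q, a'; split=> //.
move: H; have -> : (a.+1 * N.+1 + (N - r)) = (a * N.+1 + (N - 0)).+1 by lia.
by rewrite ltnS.
Qed.

Lemma word_tape_nth (w : seq (alphabet L)) (p : nat) : p < size w ->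
  @word_tape _ kmachine w p = Some (inl (nth (tick L) w p)).
Proof. by move=> pw; rewrite /word_tape (nth_map (tick L)). Qed.

Lemma word_tape_default (w : seq (alphabet L)) (p : nat) : size w <= p ->
  @word_tape _ kmachine w p = None.
Proof. by move=> wp; rewrite /word_tape nth_default // size_map. Qed.

Lemma kmachine_correct (k : nat) (s : seq (alphabet L)) :
  all (predC1 (tick L)) s -> s != [::] ->
  let w := nseq k (tick L) ++ s in
  exists2 t, t <= 2 * size w + 5 &
    computes_within kmachine w t
      (if count_mem (newrow L) s < k.+1 * N.+1 then w
       else [:: newrow L; isolated_entry]).
Proof.
move=> st s0 w; set T := @word_tape _ kmachine w.
have sw : size w = k + size s by rewrite /w size_cat size_nseq.
have Tk p : p < k -> T p = Some (inl (tick L)).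
  by move=> pk; rewrite /T word_tape_nth ?sw ?ltn_addr //
     /w nth_cat size_nseq pk nth_nseq pk.
have Ts i : i < size s -> T (k + i) = Some (inl (nth (tick L) s i)).
  move=> si; rewrite /T word_tape_nth ?sw ?ltn_add2l //.
  by rewrite /w nth_cat size_nseq ltnNge leq_addr /= addKn.
have Tkt : T k <> Some (inl (tick L)).
  have s1 : 0 < size s by case: (s) s0.
  have := Ts 0 s1; rewrite addn0 => -> [tE].
  by have /= := allP st _ (mem_nth (tick L) s1); rewrite tE eqxx.
have Tw : T (k + size s) = None by rewrite /T word_tape_default ?sw.
have [q [a [run]]] := @iter_row T s k k 0 (leq0n N) st Ts.
have run1 : iter (size s + (1 + (k + 1))) (@step _ kmachine)
    (init_config kmachine w) = kconfig q (size w) a (size w) T marked marked.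
  by rewrite iterD (iterD 1) (iterD k) /= init_kconfig step_init iter_count //
     step_count // run sw.
(* The initial budget k (N + 1) + N is one less than the threshold. *)
rewrite subn0 -ltnS -addnS -mulSnr; case: ifP => _.
  case=> i qi; exists (1 + (size s + (1 + (k + 1)))); first by lia.
  rewrite /computes_within iterD run1 qi /= step_kconfig //= sw Tw /=.
  by rewrite !upd_id -Tw upd_id; split.
(* After the overflow: one step back from the blank, [(size w).-1] erasing steps, two writing
   steps. *)
move=> qo; exists (2 + (size w).-1 + (1 + (size s + (1 + (k + 1))))).
  by lia.
rewrite /computes_within iterD (iterD 1) run1 qo /= step_kconfig //= sw Tw /=.
rewrite !upd_id -Tw upd_id -sw add0n iter_erase.
rewrite (@step_kconfig q_erase 0 a 0) //=; split=> // p.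
rewrite /on_tape /upd /=.
case: p => [|[|p]] //=.
rewrite [RHS]word_tape_default //; case: leqP => // pw.
by rewrite /T word_tape_default //; move: pw; case: (size w).
Qed.

End ThresholdMachine.

(** * Connectivity by cuts, and blocks *)

Section CutConnectivity.
Variables (V : finType) (e : rel V).
Hypothesis e_sym : symmetric e.
Implicit Types S T X Y : {set V}.

(** These are the unions of components of the subgraph on [S], described without paths. *)
Definition closed_in S X :=
  (X \subset S) && [forall x in X, forall y in S, e x y ==> (y \in X)].

(* The empty set counts as connected. *)
Definition conn S := [forall X, closed_in S X ==> (X == set0) || (X == S)].

Definition linked X Y := [exists x in X, exists y in Y, e x y].

Lemma closed_inP S X :
  reflect (X \subset S /\ forall x y, x \in X -> y \in S -> e x y -> y \in X)
          (closed_in S X).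
Proof.
apply: (iffP andP) => -[XS H]; split=> //.
  by move=> x y xX yS xy; move/forall_inP/(_ x xX)/forall_inP: H => /(_ y yS);
     rewrite xy.
by apply/forall_inP => x xX; apply/forall_inP => y yS; apply/implyP; exact: H.
Qed.

Lemma connP S :
  reflect (forall X, closed_in S X -> X != set0 -> X = S) (conn S).
Proof.
apply: (iffP forallP) => [H X XS X0|H X].
  by have := H X; rewrite XS (negPf X0) => /eqP.
by apply/implyP => /H; case: eqP => //= _ ->.
Qed.

Lemma linkedP X Y :
  reflect (exists x y, [/\ x \in X, y \in Y & e x y]) (linked X Y).
Proof.
apply: (iffP exists_inP) => [[x xX /exists_inP[y yY xy]]|[x [y [xX yY xy]]]].
  by exists x, y.
by exists x => //; apply/exists_inP; exists y.
Qed.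

Lemma linked_sub X X' Y Y' :
  X \subset X' -> Y \subset Y' -> linked X Y -> linked X' Y'.
Proof.
move=> XX' YY' /linkedP[x [y [xX yY xy]]]; apply/linkedP.
by exists x, y; rewrite (subsetP XX') // (subsetP YY').
Qed.

Lemma closed_in_refl S : closed_in S S.
Proof. by apply/closed_inP; split. Qed.

Lemma closed_inD S X : closed_in S X -> closed_in S (S :\: X).
Proof.
case/closed_inP=> XS cX; apply/closed_inP; split; first exact: subsetDl.
move=> x y; rewrite !inE => /andP[xX xS] yS xy; rewrite yS andbT.
by apply: contra xX => yX; apply: cX yX xS _; rewrite e_sym.
Qed.

Lemma closed_in_trans S X Y : closed_in S X -> closed_in X Y -> closed_in S Y.
Proof.
case/closed_inP=> XS cX /closed_inP[YX cY]; apply/closed_inP; split.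
  exact: subset_trans YX XS.
by move=> x y xY yS xy; apply: (cY x) => //; apply: (cX x) => //;
   exact: (subsetP YX).
Qed.

Lemma closed_in_sub S X Y : closed_in S X -> Y \subset S -> X \subset Y ->
  closed_in Y X.
Proof.
case/closed_inP=> XS cX YS XY; apply/closed_inP; split=> // x y xX yY.
by apply: cX => //; exact: (subsetP YS).
Qed.

Lemma closed_in_unlinked S X Y : closed_in S X -> Y \subset S ->
  [disjoint X & Y] -> ~~ linked X Y.
Proof.
case/closed_inP=> XS cX YS dXY; apply/linkedP => -[x [y [xX yY xy]]].
have := cX x y xX (subsetP YS y yY) xy.
by rewrite (disjointFl dXY).
Qed.

(** A closed part missing [B] lies in [T] and would be linked to [B], so it is empty. Any other
    closed part contains all of [B], and its complement misses [B]. Connectivity after a deletion is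
    derived from this. *)
Lemma conn_attach B T : conn B ->
  (forall X, closed_in T X -> X != set0 -> linked X B) -> conn (B :|: T).
Proof.
move=> /connP cB att.
have key X : closed_in (B :|: T) X -> X :&: B = set0 -> X = set0.
  move=> /closed_inP[XS cX] XB; apply/eqP/negPn/negP => X0.
  have XT : X \subset T.
    apply/subsetP => x xX; have := subsetP XS x xX; rewrite inE => /orP[xB|//].
    by have : x \in X :&: B by [rewrite inE xX]; rewrite XB inE.
  have /linkedP[x [y [xX yB xy]]] : linked X B.
    apply: att => //; apply/closed_inP; split=> // x y xX yT.
    by apply: cX => //; rewrite inE yT orbT.
  have : y \in X :&: B by rewrite inE yB (cX x) // inE yB.
  by rewrite XB inE.
apply/connP => X cX X0; have [XS cX'] := closed_inP _ _ cX.
have [XB0|XB0] := eqVneq (X :&: B) set0; first by rewrite (key X) // eqxx in X0.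
have XB : X :&: B = B.
  apply: cB => //; apply/closed_inP; split; first exact: subsetIr.
  move=> x y; rewrite !inE => /andP[xX xB] yB xy; rewrite yB andbT.
  by apply: (cX' x) => //; rewrite inE yB.
apply/eqP; rewrite eqEsubset XS /= -setD_eq0; apply/eqP/key.
  exact: closed_inD.
have BX : B \subset X by rewrite -XB subsetIl.
apply/setP => z; rewrite !inE.
by case: (boolP (z \in B)) => [zB|_]; rewrite ?andbF // (subsetP BX).
Qed.

Lemma conn1 x : conn [set x].
Proof.
apply/connP => X /closed_inP[]; rewrite subset1 => /orP[/eqP ->//|/eqP ->].
by rewrite eqxx.
Qed.

Lemma conn0 : conn set0.
Proof.
by apply/connP => X /closed_inP[]; rewrite subset0 => /eqP ->.
Qed.

Lemma conn_linked S X : conn S -> X \subset S -> X != set0 -> X != S ->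
  linked X (S :\: X).
Proof.
move=> /connP cS XS X0 XneS; apply: contraNT XneS => nl; apply/eqP/cS => //.
apply/closed_inP; split=> // x y xX yS xy; apply: contraNT nl => yX.
by apply/linkedP; exists x, y; rewrite inE yX.
Qed.

(** A smallest nonempty closed subset is a component. *)
Lemma minimal_closed_in S X : closed_in S X -> X != set0 ->
  exists C, [/\ closed_in S C, C \subset X, C != set0 & conn C].
Proof.
move=> cX X0; pose P C := [&& closed_in S C, C \subset X & C != set0].
have PX : P X by rewrite /P cX subxx.
case: (arg_minnP (fun C : {set V} => #|C|) PX) => C /and3P[cC CX C0] minC.
exists C; split=> //; apply/connP => D cD D0.
have [DC _] := closed_inP _ _ cD.
apply/eqP; rewrite eqEcard DC; apply: minC; apply/and3P; split=> //.
  exact: closed_in_trans cD.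
exact: subset_trans CX.
Qed.

Lemma connect_conn : (forall x y, connect e x y) <-> conn setT.
Proof.
split=> [H|/connP H x y].
  apply/connP => X /closed_inP[_ cX] /set0Pn[x xX].
  apply/setP => y; rewrite inE.
  rewrite -(closed_connect (a := X) _ (H x y)) // => a b ab.
  by apply/idP/idP => ?; [apply: (cX a) | apply: (cX b)];
     rewrite ?inE // e_sym.
have XT : [set y | connect e x y] = setT.
  apply: H; last by apply/set0Pn; exists x; rewrite inE connect0.
  apply/closed_inP; split=> // a b; rewrite !inE => xa _ ab.
  exact: connect_trans xa (connect1 ab).
by have := in_setT y; rewrite -XT inE.
Qed.

Lemma n_comp_le1 : n_comp e V <= 1 <-> forall x y, connect e x y.
Proof.
have cs := sym_connect_sym e_sym.
split=> [/card_le1_eqP H x y|H].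
  rewrite -(root_connect cs).
  by rewrite (H (fingraph.root e y) (fingraph.root e x)) // !inE /= andbT;
     exact: roots_root.
apply/card_le1_eqP => x y; rewrite !inE /= !andbT => /eqP <- /eqP <-.
by apply/eqP; rewrite (root_connect cs).
Qed.

End CutConnectivity.

Lemma conn_imset (V W : finType) (e : rel V) (e' : rel W) (f : V -> W)
    (S : {set V}) : injective f -> (forall x y, e x y = e' (f x) (f y)) ->
  conn e S = conn e' (f @: S).
Proof.
move=> fI fe; apply/connP/connP => H X cX X0.
  have [XS cX'] := closed_inP _ _ _ cX.
  have fX : f @: (f @^-1: X) = X.
    apply/setP => y; apply/imsetP/idP => [[x]|yX]; first by rewrite inE => ? ->.
    have /imsetP[x xS yx] := subsetP XS y yX.
    by exists x => //; rewrite inE -yx.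
  rewrite -fX (H (f @^-1: X)) //.
    apply/closed_inP; split=> [|x y].
      apply/subsetP => x; rewrite inE => /(subsetP XS) /imsetP[x' x'S /fI ->//].
    by rewrite !inE => xX yS xy; apply: cX' xX _ _; rewrite ?imset_f // -fe.
  by apply: contra_neq X0 => X0; rewrite -fX X0 imset0.
have [XS cX'] := closed_inP _ _ _ cX.
apply: (imset_inj fI); apply: H.
  apply/closed_inP; split; first exact: imsetS.
  move=> _ _ /imsetP[x xX ->] /imsetP[y yS ->]; rewrite -fe => xy.
  by rewrite imset_f // (cX' x).
by rewrite imset_eq0.
Qed.

(** * Nonseparable vertex sets and blocks *)

Section Nonseparable.
Variables (L : finType) (V : finType).
Implicit Types (G H : lgraph L V) (A B : {set V}).

Lemma connectedP G : connected G <-> (0 < #|V|) /\ conn (adj G) setT.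
Proof.
by rewrite /connected; split=> -[? ?]; split=> //; apply/connect_conn => //;
   exact: adj_sym.
Qed.

Lemma conn_induced G A (X : {set {x | x \in A}}) :
  conn (adj (induced G A)) X = conn (adj G) (val @: X).
Proof. by apply: conn_imset => //; exact: val_inj. Qed.

Lemma imset_val_setT A : val @: [set: {x | x \in A}] = A.
Proof.
apply/setP => x; apply/imsetP/idP => [[[y yA] _ ->]//|xA].
by exists (exist _ x xA).
Qed.

(** Since [G] has one component, [v] is a cut vertex when its deletion leaves at least two. Deleting
    the only vertex leaves none, in line with the convention that the empty set is connected. *)
Lemma not_cut_vertex G v : connected G ->
  ~ cut_vertex G v <-> conn (adj G) (~: [set v]).
Proof.
move=> cG; have [V0 cG'] := cG.
have n1 : ncomponents G = 1.
  have /card_gt0P[x _] := V0.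
  apply/eqP; rewrite eqn_leq; apply/andP; split.
    by apply/(n_comp_le1 (@adj_sym _ _ G)).
  rewrite lt0n; apply/eqP => /eqP/pred0P/(_ (fingraph.root (adj G) x)).
  by rewrite /= !inE /= roots_root //; exact: sym_connect_sym (@adj_sym _ _ G).
rewrite /cut_vertex n1.
have -> : conn (adj G) (~: [set v]) =
    conn (adj (induced G (~: [set v]))) setT.
  by rewrite conn_induced imset_val_setT.
rewrite -connect_conn; last exact: adj_sym.
rewrite -n_comp_le1; last exact: adj_sym.
by rewrite ltnNge; split=> [/negP/negPn|->].
Qed.

(** Phrased for vertex sets of one fixed graph, so that iterated induced subgraphs and their subset
    types are avoided. *)
Definition nonsep G B :=
  [/\ B != set0, conn (adj G) B & forall v, v \in B -> conn (adj G) (B :\ v)].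

Lemma nonseparableP G : nonseparable G <-> nonsep G setT.
Proof.
have T0 : (0 < #|V|) = ([set: V] != set0) by rewrite -cardsT card_gt0.
split=> [[cG H]|[V0 cG H]].
  have /connectedP[V0 cT] := cG.
  split=> // [|v _]; first by rewrite -T0.
  by rewrite setTD; apply/not_cut_vertex => //; exact: H.
have cG' : connected G by apply/connectedP; rewrite T0.
split=> // v; apply/not_cut_vertex => //.
by rewrite -setTD; apply: H; rewrite inE.
Qed.

End Nonseparable.

Lemma nonsep_induced (L V : finType) (G : lgraph L V) (A : {set V})
    (X : {set {x | x \in A}}) :
  nonsep (induced G A) X <-> nonsep G (val @: X).
Proof.
rewrite /nonsep imset_eq0 conn_induced.
have vD (x : {x | x \in A}) : val @: (X :\ x) = (val @: X) :\ val x.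
  apply/setP => y; rewrite !inE.
  apply/imsetP/andP => [[z]|[yx /imsetP[z zX yz]]].
    rewrite !inE => /andP[zx zX] ->; split; last exact: imset_f.
    by apply: contra_neq zx => /val_inj.
  by exists z => //; rewrite !inE zX andbT; apply: contra_neq yx => <-.
split=> -[? ? H]; split=> // v.
  by case/imsetP=> x xX ->; rewrite -vD -conn_induced; exact: H.
by move=> vX; rewrite conn_induced vD; apply: H; exact: imset_f.
Qed.

Lemma nonseparable_induced (L V : finType) (G : lgraph L V) (B : {set V}) :
  nonseparable (induced G B) <-> nonsep G B.
Proof. by rewrite nonseparableP nonsep_induced imset_val_setT. Qed.

Lemma block_induced (L V : finType) (G : lgraph L V) (A B : {set V}) :
  B \subset A -> block G B ->
  block (induced G A) [set x : {x | x \in A} | val x \in B].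
Proof.
move=> BA [nB maxB].
have vB : val @: [set x : {x | x \in A} | val x \in B] = B.
  apply/setP => x; apply/imsetP/idP => [[y]|xB]; first by rewrite inE => ? ->.
  by exists (exist _ x (subsetP BA x xB)); rewrite ?inE.
split; first by apply/nonseparable_induced/nonsep_induced; rewrite vB;
  exact/nonseparable_induced.
move=> B' sBB' /nonseparable_induced/nonsep_induced nB'.
apply: (imset_inj val_inj); rewrite vB; apply: maxB.
  by rewrite -vB imsetS.
exact/nonseparable_induced.
Qed.

(** Otherwise C - r meets both sides with no edge between them, although C - r is connected, whether
    or not r lies in C. *)
Lemma nonsep_one_side (L V : finType) (G : lgraph L V) (A B C : {set V})
    (r : V) :
  A :&: B = [set r] -> ~~ linked (adj G) (A :\ r) (B :\ r) ->
  C \subset A :|: B -> nonsep G C -> (C \subset A) || (C \subset B).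
Proof.
move=> AB nl CAB [_ cC cCv].
case: (boolP (C \subset A)) => //= nCA; apply/negPn/negP => nCB.
have /subsetPn[y yC yA] := nCA; have /subsetPn[x xC xB] := nCB.
have xA : x \in A by have := subsetP CAB x xC; rewrite inE (negPf xB) orbF.
have yB : y \in B by have := subsetP CAB y yC; rewrite inE (negPf yA).
have rAB : r \in A :&: B by rewrite AB inE.
have [rA rB] : r \in A /\ r \in B by move: rAB; rewrite inE => /andP.
have cCr : conn (adj G) (C :\ r).
  case: (boolP (r \in C)) => [/cCv//|rC].
  by have -> : C :\ r = C by apply/setDidPl; rewrite disjoint_sym disjoints1.
have : linked (adj G) ((C :\ r) :&: A) (C :\ r :\: ((C :\ r) :&: A)).
  apply: conn_linked cCr _ _ _; first exact: subsetIl.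
    by apply/set0Pn; exists x; rewrite !inE xA xC !andbT;
       apply: contraNneq xB => ->.
  apply/eqP => /setP/(_ y); rewrite !inE (negPf yA) andbF yC andbT => /esym.
  by move/negbT; rewrite negbK => /eqP yr; rewrite yr rA in yA.
apply/negP; apply: contra nl; apply: linked_sub.
  by apply/subsetP => z; rewrite !inE => /andP[/andP[-> _] ->].
apply/subsetP => z; rewrite !inE => /andP[H /andP[zr zC]].
rewrite zr /=; have := subsetP CAB z zC; rewrite inE => /orP[zA|//].
by rewrite zr zC zA in H.
Qed.

Local Open Scope ring_scope.

(** * Surplus over the Poljak-Turzik bound *)

Section EdgeSets.
Variables (L V : finType) (G : lgraph L V).
Implicit Types (S U W : {set V}) (D : {set {set V}}).

Lemma set2_eq (x y a b : V) : [set x; y] = [set a; b] ->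
  x = a /\ y = b \/ x = b /\ y = a.
Proof.
move=> E.
have /set2P[xa|xb] : x \in [set a; b] by rewrite -E set21.
  have /set2P[ya|yb] : y \in [set a; b] by rewrite -E set22.
    have : b \in [set x; y] by rewrite E set22.
    by rewrite xa ya setUid inE => /eqP ->; left.
  by left.
have /set2P[ya|yb] : y \in [set a; b] by rewrite -E set22.
  by right.
have : a \in [set x; y] by rewrite E set21.
by rewrite xb yb setUid inE => /eqP ->; left.
Qed.

Lemma in_edges_between U W x y :
  ([set x; y] \in edges_between G U W) =
  adj G x y && ((x \in U) && (y \in W) || (y \in U) && (x \in W)).
Proof.
apply/imset2P/idP => [[a b aU]|/andP[xy /orP[/andP[xU yW]|/andP[yU xW]]]].
- rewrite inE => /andP[bW ab] /set2_eq[[-> ->]|[-> ->]].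
    by rewrite ab aU bW.
  by rewrite adj_sym ab aU bW orbT.
- by exists x y; rewrite ?inE ?yW.
- by exists y x; rewrite ?inE ?xW 1?setUC // adj_sym.
Qed.

Lemma edges_betweenP U W (E : {set V}) :
  reflect (exists x y, [/\ x \in U, y \in W, adj G x y & E = [set x; y]])
          (E \in edges_between G U W).
Proof.
apply: (iffP imset2P) => [[x y xU]|[x [y [xU yW xy ->]]]].
  by rewrite inE => /andP[yW xy] ->; exists x, y.
by exists x y; rewrite ?inE ?yW.
Qed.

Lemma card_edges_between U W : [disjoint U & W] ->
  #|edges_between G U W| = (\sum_(x in U) \sum_(y in W) adj G x y)%N.
Proof.
move=> dUW.
pose P := [set p : V * V | [&& p.1 \in U, p.2 \in W & adj G p.1 p.2]].
have -> : edges_between G U W = [set [set p.1; p.2] | p in P].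
  apply/setP => E; apply/edges_betweenP/imsetP.
    by move=> [x [y [xU yW xy ->]]]; exists (x, y); rewrite // inE /= xU yW.
  move=> [[x y]]; rewrite inE /= => /and3P[xU yW xy] ->.
  by exists x, y.
rewrite card_in_imset; last first.
  move=> [x y] [a b]; rewrite !inE /= => /and3P[xU yW _] /and3P[aU bW _].
  move=> /set2_eq[[-> ->//]|[xb ya]].
  by have := disjointFr dUW xU; rewrite xb bW.
rewrite pair_big_dep /= -sum1_card big_mkcond [RHS]big_mkcond /=.
apply: eq_bigr => -[x y] _ /=; rewrite !inE /=.
by case: (x \in U) => //=; case: (y \in W) => //=; case: (adj G x y).
Qed.

Definition inner S := edges_between G S S.

Lemma in_inner S x y :
  ([set x; y] \in inner S) = [&& adj G x y, x \in S & y \in S].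
Proof. by rewrite in_edges_between [(y \in S) && _]andbC orbb. Qed.

Definition agree (H H' : lgraph L V) U := forall x y, x \in U -> y \in U ->
  [/\ adj H x y = adj H' x y, ori H x y = ori H' x y & lab H x y = lab H' x y].

(** Non-edges carry neither orientation nor label, so only edges inside [U] have to be compared. *)
Lemma agree_del_edges D D' U :
  (forall x y, x \in U -> y \in U -> adj G x y ->
     ([set x; y] \in D) = ([set x; y] \in D')) ->
  agree (del_edges G D) (del_edges G D') U.
Proof.
move=> DD' x y xU yU /=; have [xy|nxy] := boolP (adj G x y).
  by rewrite (DD' x y).
have no : ori G x y = false by apply: contraNF nxy; exact: ori_adj.
have nl : lab G x y = None.
  case E : (lab G x y) => [l|//].
  by rewrite (@lab_adj _ _ G x y) ?E in nxy.
by rewrite no nl !if_same.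
Qed.

End EdgeSets.

Arguments edges_betweenP {L V G U W E}.

Lemma edges_between_subr (L V : finType) (G : lgraph L V)
    (U U' W W' : {set V}) :
  U \subset U' -> W \subset W' ->
  edges_between G U W \subset edges_between G U' W'.
Proof.
move=> UU' WW'; apply/subsetP => E /edges_betweenP[x [y [xU yW xy ->]]].
by rewrite in_edges_between xy (subsetP UU') // (subsetP WW').
Qed.

(** * Restriction and gluing for [Pi] *)

Section Property.
Variables (R : realType) (lam : R) (L : finType) (GG Pi : graph_family L).
Hypothesis lam01 : 0 < lam < 1.
Hypothesis GG_sub : subgraph_closed GG.
Hypothesis Pi_prop : graph_property GG Pi.
Hypothesis Pi_ext : strongly_extendible lam GG Pi.

Let Pi_iso := Pi_prop.2.

Lemma GG_induced (V : finType) (G : lgraph L V) S : GG G -> GG (induced G S).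
Proof. by apply: GG_sub; exists val => //; exact: val_inj. Qed.

Lemma GG_del_edges (V : finType) (G : lgraph L V) D :
  GG G -> GG (del_edges G D).
Proof.
by apply: GG_sub; exists id => // x y /= /andP[-> ->]; rewrite andbT.
Qed.

Lemma Pi_agree (V : finType) (H H' : lgraph L V) U :
  agree H H' U -> Pi (induced H U) -> Pi (induced H' U).
Proof.
move=> HH'; apply: Pi_iso; exists id; first by exists id.
by move=> [x xU] [y yU] /=; exact: HH'.
Qed.

Definition preset (V : finType) (S U : {set V}) : {set {x | x \in S}} :=
  [set x | val x \in U].

(** Inducing on [U] directly or by way of [S] gives different subset types; this bijection carries
    [Pi] between them. *)
Lemma preset_bijection (V : finType) (S U : {set V}) :
  U \subset S ->
  exists2 f : {x | x \in U} -> {x | x \in preset S U}, bijective f &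
    forall x, val (val (f x)) = val x.
Proof.
move=> US.
have h1 (x : {x | x \in U}) : val x \in S.
  by apply: (subsetP US); exact: (valP x).
have h2 (x : {x | x \in U}) : (exist _ (val x) (h1 x) : {x | x \in S})
    \in preset S U by rewrite inE; exact: (valP x).
have h3 (x : {x | x \in preset S U}) : val (val x) \in U.
  by have := valP x; rewrite inE.
exists (fun x => @exist _ (fun z => is_true (z \in preset S U)) _ (h2 x)) => //.
exists (fun x => @exist _ (fun z => is_true (z \in U)) _ (h3 x)) => x /=.
  by apply: (@val_inj _ _ {x | x \in U}).
apply: (@val_inj _ _ {x | x \in preset S U}).
by apply: (@val_inj _ _ {x | x \in S}).
Qed.

Lemma Pi_preset (V : finType) (H : lgraph L V) (S U : {set V}) :
  U \subset S -> Pi (induced H U) -> Pi (induced (induced H S) (preset S U)).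
Proof.
move=> US; have [f fB fE] := preset_bijection US.
by apply: Pi_iso; exists f => // x y /=; rewrite !fE.
Qed.

Lemma Pi_preset_inv (V : finType) (H : lgraph L V) (S U : {set V}) :
  U \subset S -> Pi (induced (induced H S) (preset S U)) -> Pi (induced H U).
Proof.
move=> US; have [f [g fg gf] fE] := preset_bijection US.
apply: Pi_iso; exists g; first by exists f.
by move=> x y /=; rewrite -!fE !gf.
Qed.

(** Every block of [H] lies in [A] or in [B], and it is then a block of that side; block additivity
    is used in both directions. *)
Lemma Pi_glue (V : finType) (H : lgraph L V) (A B : {set V}) (r : V) :
  GG H -> A :|: B = setT -> A :&: B = [set r] ->
  ~~ linked (adj H) (A :\ r) (B :\ r) ->
  Pi (induced H A) -> Pi (induced H B) -> Pi H.
Proof.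
move=> GH AB ABr nl PA PB; have [_ badd _] := Pi_ext.
apply/badd => // C bC.
have [nC _] := bC; have {}nC := (nonseparable_induced H C).1 nC.
have CAB : C \subset A :|: B by rewrite AB subsetT.
have side S : Pi (induced H S) -> C \subset S -> Pi (induced H C).
  move=> PS CS; apply: (Pi_preset_inv CS).
  by apply: (badd _ _ (GG_induced S GH)).1 => //; exact: block_induced.
by case/orP: (nonsep_one_side ABr nl CAB nC); exact: side.
Qed.

Lemma Pi_clique (n : nat) (V : finType) (H : lgraph L V) (S : {set V}) :
  contains_K n GG Pi -> GG H -> #|S| = n ->
  (forall x y, x \in S -> y \in S -> x != y -> adj H x y) ->
  Pi (induced H S).
Proof.
move=> PK GH Sn SK; apply: PK; first exact: GG_induced.
have cT : #|{: {x | x \in S}}| = n by rewrite card_sig -Sn; apply: eq_card.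
exists (fun x => cast_ord cT (enum_rank x)).
  exists (fun i => enum_val (cast_ord (esym cT) i)) => x.
    by rewrite cast_ordK enum_rankK.
  by rewrite enum_valK cast_ordKV.
move=> x y /=; split=> //.
rewrite (inj_eq (@cast_ord_inj _ _ _)) (inj_eq enum_rank_inj).
have [->|xy] := eqVneq x y; first by rewrite adj_irr.
by apply: SK; rewrite ?(valP x) ?(valP y).
Qed.


Section Surplus.
Variables (V : finType) (G : lgraph L V).
Hypothesis GG_G : GG G.
Implicit Types (S U W A B C Q X Y : {set V}) (D : {set {set V}}) (s : R).

(* The term (1 - lam) / 2 * (#|S| - 1) of the Poljak-Turzik bound is replaced *)
(* by (1 - lam) / 2 * #|S|, which makes the surplus superadditive.            *)
Definition surplus S s := exists D,
  Pi (induced (del_edges G D) S) /\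
  lam * #|inner G S|%:R + (1 - lam) / 2 * #|S|%:R + s
    <= #|inner G S :\: D|%:R.

Lemma surplus_le S s s' : s' <= s -> surplus S s -> surplus S s'.
Proof. by move=> ss' [D [PD H]]; exists D; split=> //; lra. Qed.

Lemma inner_setU U W :
  inner G (U :|: W) \subset inner G U :|: inner G W :|: edges_between G U W.
Proof.
apply/subsetP => E /edges_betweenP[x [y [xS yS xy ->]]].
rewrite !inE !in_edges_between xy /=; move: xS yS; rewrite !inE.
by do 4![case: (_ \in _)].
Qed.

Lemma card_inner_setU U W :
  (#|inner G (U :|: W)| <=
     #|inner G U| + #|inner G W| + #|edges_between G U W|)%N.
Proof.
apply: leq_trans (subset_leq_card (inner_setU U W)) _.
apply: leq_trans (leq_card_setU _ _) _; rewrite leq_add2r.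
exact: leq_card_setU.
Qed.

(** Good subgraphs of both sides are extended across the cut. The number f of kept crossing edges is
    exposed as an integer for rounding. *)
Lemma surplus_join U W s1 s2 : [disjoint U & W] ->
  surplus U s1 -> surplus W s2 ->
  exists f : nat, lam * #|edges_between G U W|%:R <= f%:R /\
    surplus (U :|: W) (s1 + s2 + (f%:R - lam * #|edges_between G U W|%:R)).
Proof.
move=> dUW [D1 [P1 H1]] [D2 [P2 H2]]; set S := U :|: W.
have US : U \subset S by exact: subsetUl.
have WS : W \subset S by exact: subsetUr.
have dis x : x \in U -> x \in W -> False.
  by move=> xU; rewrite (disjointFr dUW xU).
(* Deletions are confined to edges inside one side, so every crossing edge is still present when
   strong extension is applied. *)
pose D := (D1 :&: inner G U) :|: (D2 :&: inner G W).
pose H := del_edges G D; pose K := induced H S.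
have aU : agree (del_edges G D1) H U.
  apply: agree_del_edges => x y xU yU xy; rewrite !inE !in_inner xy xU yU /=.
  by rewrite (disjointFr dUW xU) /= andbF orbF andbT.
have aW : agree (del_edges G D2) H W.
  apply: agree_del_edges => x y xW yW xy; rewrite !inE !in_inner xy xW yW /=.
  by rewrite (disjointFl dUW xW) /= andbF andbT.
have PU := Pi_preset US (Pi_agree aU P1).
have PW := Pi_preset WS (Pi_agree aW P2).
have GK : GG K by apply: GG_induced; exact: GG_del_edges.
have [_ _ ext] := Pi_ext.
have UWT : preset S U :|: preset S W = setT.
  by apply/setP => x; rewrite !inE; have := valP x; rewrite inE.
have dUW' : [disjoint preset S U & preset S W].
  rewrite -setI_eq0; apply/eqP/setP => x; rewrite !inE.
  by apply/negP => /andP[/dis].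
have [F [FE HF PF]] := ext _ K _ _ GK UWT dUW' PU PW.
have notD x y : x \in U -> y \in W -> [set x; y] \notin D.
  move=> xU yW; rewrite !inE !in_inner (disjointFr dUW xU) (disjointFl dUW yW).
  by rewrite /= !andbF.
set EK := edges_between K _ _ in FE HF PF *.
have vI : injective (fun E : {set {x | x \in S}} => val @: E).
  by apply: imset_inj; exact: val_inj.
have vset2 (x y : {x | x \in S}) : val @: [set x; y] = [set val x; val y].
  by rewrite imsetU1 imset_set1.
have EKE :
    edges_between G U W = (fun E : {set {x | x \in S}} => val @: E) @: EK.
  apply/setP => E; apply/edges_betweenP/imsetP => [[x [y [xU yW xy ->]]]|].
    pose x' : {x | x \in S} := exist _ x (subsetP US x xU).
    pose y' : {x | x \in S} := exist _ y (subsetP WS y yW).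
    exists [set x'; y']; last by rewrite vset2.
    rewrite in_edges_between [adj K _ _]/= xy (notD _ _ xU yW).
    by rewrite !inE /= xU yW.
  move=> [E' /edges_betweenP[x [y [xU yW /andP[xy _] ->]]] ->].
  rewrite !inE in xU yW; exists (val x), (val y); by rewrite vset2.
set e := edges_between G U W in EKE *.
have ce : #|e| = #|EK| by rewrite EKE card_imset.
pose F' := (fun E : {set {x | x \in S}} => val @: E) @: F.
have F'e : F' \subset e by rewrite EKE; exact: imsetS.
exists #|F|; rewrite ce; split=> //.
exists (D :|: (e :\: F')); split.
  apply: Pi_iso PF; exists id; first by exists id.
  move=> x y /=.
  have -> : ([set val x; val y] \in D :|: e :\: F') =
     ([set val x; val y] \in D) || ([set x; y] \in EK :\: F).
    rewrite in_setU !in_setD -vset2 (mem_imset _ _ vI).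
    by rewrite EKE (mem_imset _ _ vI).
  rewrite negb_or -/D; split; first by rewrite andbA.
    by rewrite andbA.
  by case: (_ \in D) => //=; case: (_ \notin _).
have cF : #|F'| = #|F| by rewrite card_imset.
have sub : (inner G U :\: D1) :|: (inner G W :\: D2) :|: F' \subset
    inner G S :\: (D :|: e :\: F').
  apply/subsetP => E; rewrite in_setU in_setU !in_setD => /orP[/orP[]|].
  - move=> /andP[ED1 /edges_betweenP[x [y [xU yU xy EE]]]]; subst E.
    rewrite in_inner xy (subsetP US _ xU) (subsetP US _ yU).
    rewrite !in_setU !in_setI (negPf ED1) !in_inner in_setD in_edges_between.
    by rewrite (disjointFr dUW xU) (disjointFr dUW yU) !andbF.
  - move=> /andP[ED2 /edges_betweenP[x [y [xW yW xy EE]]]]; subst E.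
    rewrite in_inner xy (subsetP WS _ xW) (subsetP WS _ yW).
    rewrite !in_setU !in_setI (negPf ED2) !in_inner in_setD in_edges_between.
    by rewrite (disjointFl dUW xW) (disjointFl dUW yW) /= !andbF.
  move=> EF'; have := subsetP F'e E EF' => /edges_betweenP[x [y [xU yW xy EE]]].
  rewrite in_setU in_setD EF' orbF; subst E.
  by rewrite (notD _ _ xU yW) in_inner xy (subsetP US _ xU) (subsetP WS _ yW).
have disj : [disjoint inner G U :\: D1 & inner G W :\: D2].
  rewrite -setI_eq0; apply/eqP/setP => E; rewrite inE in_set0; apply/negP.
  rewrite !in_setD => /andP[/andP[_ /edges_betweenP[x [y [xU yU xy ->]]]]].
  by rewrite in_inner (disjointFr dUW xU) !andbF.
have disj' : [disjoint (inner G U :\: D1) :|: (inner G W :\: D2) & F'].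
  rewrite -setI_eq0; apply/eqP/setP => E; rewrite inE in_set0; apply/negP.
  move=> /andP[] /[swap] /(subsetP F'e)/edges_betweenP[x [y [xU yW xy ->]]].
  rewrite in_setU !in_setD !in_inner (disjointFr dUW xU) (disjointFl dUW yW).
  by rewrite !andbF.
have := subset_leq_card sub.
have -> : #|inner G U :\: D1 :|: inner G W :\: D2 :|: F'| =
    (#|inner G U :\: D1| + #|inner G W :\: D2| + #|F|)%N.
  by rewrite !cardsU !disjoint_setI0 // !cards0 !subn0 cF.
rewrite -(ler_nat R) !natrD.
apply: le_trans.
have cS : #|S|%:R = #|U|%:R + #|W|%:R :> R.
  by rewrite -natrD cardsU disjoint_setI0 // cards0 subn0.
have ci : #|inner G S|%:R <= #|inner G U|%:R + #|inner G W|%:R + #|EK|%:R :> R.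
  by rewrite -!natrD ler_nat -ce; exact: card_inner_setU.
have /andP[l0 _] := lam01.
have := ler_wpM2l (ltW l0) ci; rewrite cS; lra.
Qed.

Lemma surplus_disjoint U W s1 s2 : [disjoint U & W] ->
  surplus U s1 -> surplus W s2 -> surplus (U :|: W) (s1 + s2).
Proof.
move=> d sU sW; have [f [fe]] := surplus_join d sU sW.
by apply: surplus_le; lra.
Qed.

(** The integer f is at least lam e > j - 1, hence at least j. *)
Lemma surplus_round (j : nat) U W s1 s2 (e : nat) : [disjoint U & W] ->
  #|edges_between G U W| = e -> j%:R - 1 < lam * e%:R ->
  surplus U s1 -> surplus W s2 ->
  surplus (U :|: W) (s1 + s2 + (j%:R - lam * e%:R)).
Proof.
move=> d ce je sU sW; have [f []] := surplus_join d sU sW; rewrite ce => fe.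
apply: surplus_le; rewrite lerD2l lerD2r ler_nat leqNgt; apply/negP => fj.
have : (f.+1)%:R <= j%:R :> R by rewrite ler_nat.
by rewrite -natr1; lra.
Qed.

(** No edge lies in both sides or between them, while [r] is paid for twice; the gain is its weight
    (1 - lam) / 2. *)
Lemma surplus_glue A B r s1 s2 : A :&: B = [set r] ->
  ~~ linked (adj G) (A :\ r) (B :\ r) ->
  surplus A s1 -> surplus B s2 -> surplus (A :|: B) (s1 + s2 + (1 - lam) / 2).
Proof.
move=> ABr nl [D1 [P1 H1]] [D2 [P2 H2]]; set S := A :|: B.
have AS : A \subset S by exact: subsetUl.
have BS : B \subset S by exact: subsetUr.
pose D := (D1 :&: inner G A) :|: (D2 :&: inner G B).
have one x y : x \in A -> x \in B -> y \in A -> y \in B -> ~~ adj G x y.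
  move=> xA xB yA yB; have : x \in [set r] by rewrite -ABr inE xA.
  have : y \in [set r] by rewrite -ABr inE yA.
  by rewrite !inE => /eqP -> /eqP ->; rewrite adj_irr.
have aA : agree (del_edges G D1) (del_edges G D) A.
  apply: agree_del_edges => x y xA yA xy; rewrite !inE !in_inner xy xA yA /=.
  have /negPf -> : ~~ ((x \in B) && (y \in B)).
    by apply: contraTN xy => /andP[xB yB]; exact: one.
  by rewrite andbF orbF andbT.
have aB : agree (del_edges G D2) (del_edges G D) B.
  apply: agree_del_edges => x y xB yB xy; rewrite !inE !in_inner xy xB yB /=.
  have /negPf -> : ~~ ((x \in A) && (y \in A)).
    by apply: contraTN xy => /andP[xA yA]; exact: one.
  by rewrite andbF andbT.
have rA : r \in A by have := set11 r; rewrite -ABr inE => /andP[].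
have rB : r \in B by have := set11 r; rewrite -ABr inE => /andP[].
have rS := subsetP AS r rA.
exists D; split.
  apply: (Pi_glue (A := preset S A) (B := preset S B) (r := exist _ r rS)).
  - by apply: GG_induced; exact: GG_del_edges.
  - by apply/setP => x; rewrite !inE; have := valP x; rewrite inE.
  - apply/setP => x; rewrite !inE -val_eqE /= -(in_set1 (val x) r) -ABr.
    by rewrite inE.
  - apply: contra nl => /linkedP[x [y [xA yB xy]]]; apply/linkedP.
    exists (val x), (val y); move: xA yB xy; rewrite !inE -!val_eqE /=.
    by move=> /andP[-> ->] /andP[-> ->] /andP[->].
  - exact: Pi_preset AS (Pi_agree aA P1).
  - exact: Pi_preset BS (Pi_agree aB P2).
have e0 : edges_between G A B \subset inner G A :|: inner G B.
  apply/subsetP => E /edges_betweenP[x [y [xA yB xy ->]]].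
  rewrite inE !in_inner xy xA yB andbT /=.
  have [yA|yA] := boolP (y \in A) => //=; apply: contraNT nl => xB.
  apply/linkedP; exists x, y; split=> //; rewrite !inE ?xA ?yB andbT.
    by apply: contraNneq xB => ->.
  by apply: contraNneq yA => ->.
have ci : (#|inner G S| <= #|inner G A| + #|inner G B|)%N.
  apply: leq_trans (leq_card_setU _ _); apply: subset_leq_card.
  apply: subset_trans (inner_setU A B) _.
  by rewrite subUset subxx e0.
have disj : [disjoint inner G A :\: D1 & inner G B :\: D2].
  rewrite -setI_eq0; apply/eqP/setP => E; rewrite inE in_set0; apply/negP.
  rewrite !in_setD => /andP[/andP[_ /edges_betweenP[x [y [xA yA xy ->]]]]].
  rewrite in_inner => /and4P[_ _ xB yB].
  by have := one x y xA xB yA yB; rewrite xy.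
have sub : (inner G A :\: D1) :|: (inner G B :\: D2) \subset inner G S :\: D.
  apply/subsetP => E; rewrite in_setU !in_setD => /orP[].
    move=> /andP[ED1 /edges_betweenP[x [y [xA yA xy EE]]]]; subst E.
    rewrite in_inner xy (subsetP AS _ xA) (subsetP AS _ yA).
    rewrite in_setU !in_setI (negPf ED1) !in_inner xy /= andbT.
    by apply: contraTN xy => /and3P[_ xB yB]; exact: one.
  move=> /andP[ED2 /edges_betweenP[x [y [xB yB xy EE]]]]; subst E.
  rewrite in_inner xy (subsetP BS _ xB) (subsetP BS _ yB).
  rewrite in_setU !in_setI (negPf ED2) !in_inner xy /= orbF andbT.
  by apply: contraTN xy => /and3P[_ xA yA]; exact: one.
have := subset_leq_card sub.
have -> : #|inner G A :\: D1 :|: inner G B :\: D2| =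
    (#|inner G A :\: D1| + #|inner G B :\: D2|)%N.
  by rewrite !cardsU !disjoint_setI0 // !cards0 !subn0.
rewrite -(ler_nat R) natrD.
apply: le_trans.
have cS : #|S|%:R = #|A|%:R + #|B|%:R - 1 :> R.
  by rewrite -natrD -cardsUI ABr cards1 natrD addrK.
have {}ci : #|inner G S|%:R <= #|inner G A|%:R + #|inner G B|%:R :> R.
  by rewrite -!natrD ler_nat.
have /andP[l0 _] := lam01.
have := ler_wpM2l (ltW l0) ci; rewrite cS; lra.
Qed.


(** * Surplus of graphs on at most three vertices *)

Notation hh := ((1 - lam) / 2).

Lemma lam_bounds : 0 < lam /\ lam < 1.
Proof. by case/andP: lam01. Qed.

Lemma inner_le1 S : (#|S| <= 1)%N -> inner G S = set0.
Proof.
move=> /card_le1_eqP H; apply/setP => E; rewrite inE; apply/negP.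
by case/edges_betweenP=> x [y [xS yS xy _]]; rewrite (H x y) // adj_irr in xy.
Qed.

(** The empty graph has no block, so block additivity puts it in [Pi]. *)
Lemma surplus0 : surplus set0 0.
Proof.
exists set0; split; last first.
  by rewrite inner_le1 ?cards0 // set0D cards0 !mulr0 !addr0.
have [_ badd _] := Pi_ext.
apply/badd => [|B [nB _]]; first by apply: GG_induced; exact: GG_del_edges.
have [/set0Pn[x _] _ _] := (nonseparable_induced _ _).1 nB.
by have := valP x; rewrite inE.
Qed.

Lemma surplus1 x : surplus [set x] (- hh).
Proof.
have [[K1 _] _ _] := Pi_ext.
exists set0; split.
  apply: Pi_clique K1 _ _ _; rewrite ?cards1 //; first exact: GG_del_edges.
  by move=> y z; rewrite !inE => /eqP -> /eqP ->; rewrite eqxx.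
by rewrite inner_le1 ?cards1 // set0D cards0; lra.
Qed.

Lemma big_set2 (F : V -> nat) x y : x != y ->
  (\sum_(z in [set x; y]) F z = F x + F y)%N.
Proof. by move=> xy; rewrite big_setU1 ?inE //= big_set1. Qed.

Lemma edges_between_restrict U W W' : W' \subset W ->
  ~~ linked (adj G) U (W :\: W') -> edges_between G U W = edges_between G U W'.
Proof.
move=> W'W nl; apply/eqP; rewrite eqEsubset andbC edges_between_subr //=.
apply/subsetP => E /edges_betweenP[x [y [xU yW xy ->]]].
rewrite in_edges_between xy xU; case: (boolP (y \in W')) => //= yW'.
by case/negP: nl; apply/linkedP; exists x, y; rewrite inE yW'.
Qed.

(** The kept edge gains 1 - lam = 2 hh, exactly the cost of its two ends. *)
Lemma surplus2 x y : adj G x y -> surplus [set x; y] 0.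
Proof.
move=> xy; have xny : x != y by apply: contraTneq xy => ->; rewrite adj_irr.
have d : [disjoint [set x] & [set y]] by rewrite disjoints1 inE.
have [l0 l1] := lam_bounds.
have e1 : #|edges_between G [set x] [set y]| = 1%N.
  by rewrite card_edges_between // !big_set1 xy.
have j1 : 1%:R - 1 < lam * 1%:R by lra.
have := surplus_round d e1 j1 (surplus1 x) (surplus1 y).
by apply: surplus_le; lra.
Qed.

Lemma adj_neq x y : adj G x y -> x != y.
Proof. by apply: contraTneq => ->; rewrite adj_irr. Qed.

Lemma surplus_path x y z : adj G x y -> adj G y z -> ~~ adj G x z -> x != z ->
  surplus [set x; y; z] hh.
Proof.
move=> xy yz /negPf nxz xz.
have [l0 l1] := lam_bounds.
have d : [disjoint [set x; y] & [set z]].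
  by rewrite disjoint_sym disjoints1 !inE negb_or eq_sym xz eq_sym adj_neq.
have e1 : #|edges_between G [set x; y] [set z]| = 1%N.
  by rewrite card_edges_between // big_set2 ?adj_neq // !big_set1 nxz yz.
have j1 : 1%:R - 1 < lam * 1%:R by lra.
have := surplus_round d e1 j1 (surplus2 xy) (surplus1 z).
by apply: surplus_le; lra.
Qed.

Definition triangle x y z := [&& adj G x y, adj G y z & adj G x z].

(** Two edges join the third vertex to a neutral edge. The case [j = 1] is used for lam < 1/2 and
    [j = 2] for lam > 1/2. *)
Lemma surplus_triangle (j : nat) x y z : triangle x y z -> j%:R - 1 < lam * 2 ->
  surplus [set x; y; z] (j%:R - 2 * lam - hh).
Proof.
move=> /and3P[xy yz xz] j2.
have d : [disjoint [set x; y] & [set z]].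
  by rewrite disjoint_sym disjoints1 !inE negb_or ![z == _]eq_sym !adj_neq.
have e2 : #|edges_between G [set x; y] [set z]| = 2%N.
  by rewrite card_edges_between // big_set2 ?adj_neq // !big_set1 xz yz.
have := surplus_round d e2 j2 (surplus2 xy) (surplus1 z).
by apply: surplus_le; lra.
Qed.

(** All three edges are kept: 3 (1 - lam) - 3 hh = 3 hh. *)
Lemma surplus_triangle_in x y z : contains_K 3 GG Pi -> lam = 1 / 2 ->
  triangle x y z -> surplus [set x; y; z] (3 * hh).
Proof.
move=> K3 l2 /and3P[xy yz xz].
have c3 : #|[set x; y; z]| = 3%N.
  by rewrite -setUA cardsU1 cards2 !inE negb_or !adj_neq.
exists set0; split.
  apply: Pi_clique K3 _ c3 _; first exact: GG_del_edges.
  move=> a b /=; rewrite !inE -!orbA.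
  by move=> /or3P[]/eqP-> /or3P[]/eqP-> ; rewrite ?eqxx ?andbT // adj_sym.
rewrite setD0 c3.
have : (3 <= #|inner G [set x; y; z]|)%N.
  have sub : [set [set x; y]; [set y; z]; [set x; z]] \subset
      inner G [set x; y; z].
    apply/subsetP => E; rewrite !inE -!orbA.
    by move=> /or3P[]/eqP->; rewrite in_inner !inE !eqxx ?orbT ?xy ?yz ?xz.
  apply: leq_trans (subset_leq_card sub).
  have n1 : [set x; y] != [set y; z].
    apply/eqP => /set2_eq[[E _]|[E _]]; first by rewrite E adj_irr in xy.
    by rewrite E adj_irr in xz.
  have n2 : [set x; y] != [set x; z].
    apply/eqP => /set2_eq[[_ E]|[E _]]; first by rewrite E adj_irr in yz.
    by rewrite E adj_irr in xz.
  have n3 : [set y; z] != [set x; z].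
    apply/eqP => /set2_eq[[E _]|[E _]]; first by rewrite E adj_irr in xy.
    by rewrite E adj_irr in yz.
  by rewrite -setUA !cardsU1 !inE negb_or n1 n2 n3 cards1.
by rewrite -(ler_nat R) l2; lra.
Qed.

Lemma conn_card2 S : conn (adj G) S -> #|S| = 2%N ->
  exists x y, S = [set x; y] /\ adj G x y.
Proof.
move=> cS /eqP/cards2P[x [y [xy SE]]]; exists x, y; split=> //.
have : linked (adj G) [set x] (S :\: [set x]).
  apply: conn_linked => //; rewrite ?SE ?subsetU1 //.
  - by rewrite sub1set !inE eqxx.
  - by apply/set0Pn; exists x; rewrite inE.
  - by apply/eqP => /setP/(_ y); rewrite !inE eqxx orbT eq_sym (negPf xy).
case/linkedP=> a [b []]; rewrite SE !inE => /eqP -> /andP[bx].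
by rewrite (negPf bx) => /eqP ->.
Qed.

Lemma conn_card3 S : conn (adj G) S -> #|S| = 3%N ->
  exists x y z, [/\ S = [set x; y; z], adj G x y, adj G y z & x != z].
Proof.
move=> cS S3; have [x xS] : exists x, x \in S.
  by apply/set0Pn; rewrite -card_gt0 S3.
have := cardsD1 x S; rewrite xS S3 => -[] /esym/eqP/cards2P[b [c [bc SE]]].
have [xb xc] : x != b /\ x != c.
  have := set21 b c; have := set22 b c; rewrite -SE !inE ![x == _]eq_sym.
  by move=> /andP[-> _] /andP[-> _].
have {}SE : S = [set x; b; c] by rewrite -(setD1K xS) SE setUA.
wlog xb' : b c bc SE xb xc / adj G x b.
  have : linked (adj G) [set x] (S :\: [set x]).
    apply: conn_linked => //; rewrite ?SE.
    - by rewrite sub1set !inE eqxx.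
    - by apply/set0Pn; exists x; rewrite inE.
    - by apply/eqP => /setP/(_ b); rewrite !inE eqxx orbT eq_sym (negPf xb).
  case/linkedP=> a [d []]; rewrite SE !inE => /eqP -> /andP[dx].
  rewrite (negPf dx) /= => /orP[/eqP-> xb' H|/eqP-> xc' H].
    exact: (H b c).
  have SE' : S = [set x; c; b] by rewrite SE -setUA [[set b] :|: _]setUC setUA.
  by apply: (H c b) => //; [rewrite eq_sym | rewrite -SE].
have : linked (adj G) [set c] (S :\: [set c]).
  apply: conn_linked => //; rewrite ?SE.
  - by rewrite sub1set !inE eqxx orbT.
  - by apply/set0Pn; exists c; rewrite inE.
  - by apply/eqP => /setP/(_ b); rewrite !inE eqxx orbT (negPf bc).
case/linkedP=> a [d []]; rewrite SE !inE => /eqP -> /andP[dc].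
rewrite (negPf dc) orbF => /orP[/eqP-> cx|/eqP-> cb].
  exists b, x, c; split=> //; last by rewrite adj_sym.
    by rewrite [[set b; x]]setUC.
  by rewrite adj_sym.
by exists x, b, c; split=> //; rewrite adj_sym.
Qed.

(** * Connected graphs have linear surplus *)

Section LinearSurplus.
Variable eps : R.
Hypothesis eps_gt0 : 0 < eps.
Hypothesis eps_le : eps <= hh.

Definition rich_triangles :=
  forall x y z, triangle x y z -> surplus [set x; y; z] eps.

(** In this range 2, 3 or 4 crossing edges gain at least 1 - 2 lam by rounding, except 3 edges at
    lam = 1/3. *)
Definition middle_lam := [/\ 1 / 3 <= lam, lam < 1 / 2 & eps <= 1 - 2 * lam].

Hypothesis two_cases : rich_triangles \/ middle_lam.

(* A removed set has at most 4 vertices and surplus at least eps, or is all   *)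
(* of S with surplus eps/3 on at least |S|/5 of its vertices; hence the 15.   *)
Definition linear_surplus Y := surplus Y (eps / 15 * (#|Y|%:R - 1) - hh).

Section Step.
Variable Y : {set V}.
Hypothesis Y_conn : conn (adj G) Y.
Hypothesis IH : forall Z : {set V},
  (#|Z| < #|Y|)%N -> conn (adj G) Z -> linear_surplus Z.

Lemma ltn_cardD Q : Q \subset Y -> Q != set0 -> (#|Y :\: Q| < #|Y|)%N.
Proof.
move=> QY Q0; rewrite cardsD (setIidPr QY) ltn_subrL card_gt0 Q0 /=.
by apply: leq_trans (subset_leq_card QY); rewrite card_gt0.
Qed.

Lemma setDUK Q : Q \subset Y -> Q :|: (Y :\: Q) = Y.
Proof. by move=> QY; rewrite -{1}(setIidPr QY) setID. Qed.

Lemma disjointD Q : [disjoint Q & Y :\: Q].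
Proof. by rewrite -setI_eq0 setIDA setIC setDIl setDv setI0. Qed.

Lemma natr_cardD Q : Q \subset Y -> #|Y :\: Q|%:R = #|Y|%:R - #|Q|%:R :> R.
Proof.
by move=> QY; rewrite cardsD (setIidPr QY) natrB // subset_leq_card.
Qed.

(** Superadditivity for [Q] and its complement, to which the induction hypothesis applies. *)
Lemma remove_set Q s : Q \subset Y -> Q != set0 -> conn (adj G) (Y :\: Q) ->
  surplus Q s -> eps / 15 * #|Q|%:R <= s -> linear_surplus Y.
Proof.
move=> QY Q0 cD sQ le; have := IH (ltn_cardD QY Q0) cD.
move=> /(surplus_disjoint (disjointD Q) sQ); rewrite setDUK // natr_cardD //.
by apply: surplus_le; lra.
Qed.

Lemma remove_small Q s : Q \subset Y -> Q != set0 -> (#|Q| <= 4)%N ->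
  conn (adj G) (Y :\: Q) -> surplus Q s -> eps <= s -> linear_surplus Y.
Proof.
move=> QY Q0 Q4 cD sQ le; apply: remove_set sQ _ => //.
have : #|Q|%:R <= 4 :> R by rewrite (ler_nat R _ 4).
by have := eps_gt0; nra.
Qed.

Lemma remove_round (j e : nat) Q s : Q \subset Y -> Q != set0 ->
  (#|Q| <= 4)%N -> conn (adj G) (Y :\: Q) -> surplus Q s ->
  #|edges_between G Q (Y :\: Q)| = e -> j%:R - 1 < lam * e%:R ->
  eps <= s + (j%:R - lam * e%:R) -> linear_surplus Y.
Proof.
move=> QY Q0 Q4 cD sQ ce je le; have := IH (ltn_cardD QY Q0) cD.
move=> /(surplus_round (disjointD Q) ce je sQ); rewrite setDUK // natr_cardD //.
apply: surplus_le.
have : #|Q|%:R <= 4 :> R by rewrite (ler_nat R _ 4).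
by have := eps_gt0; nra.
Qed.

(** * Finding a removable set inside a rooted piece [S] *)

Section Rooted.
Variables (r : V) (S : {set V}).
Hypothesis rS : r \in S.
Hypothesis SY : S \subset Y.
Hypothesis S_conn : conn (adj G) S.
Hypothesis S_card : (4 <= #|S|)%N.
Notation S' := (S :\ r).
Notation B := (Y :\: S).
Hypothesis B_conn : conn (adj G) B.
Hypothesis r_linked : B != set0 -> linked (adj G) [set r] B.

(** Some edge of the connected set [S] leaves [X], and closedness leaves only [r] as its other
    end. *)
Lemma linked_root X : closed_in (adj G) S' X -> X != set0 ->
  linked (adj G) X [set r].
Proof.
move=> cX X0; have [XS cX'] := closed_inP _ _ _ cX.
have rX : r \notin X by apply/negP => /(subsetP XS); rewrite !inE eqxx.
have : linked (adj G) X (S :\: X).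
  apply: conn_linked => //; first exact: subset_trans XS (subsetDl _ _).
  by apply: contraNneq rX => ->.
case/linkedP=> x [y []]; rewrite inE => xX /andP[yX yS] xy.
apply/linkedP; exists x, r; rewrite set11; split=> //.
have [<-//|yr] := eqVneq y r.
by move: yX; rewrite (cX' x) // !inE yr.
Qed.

Lemma setD_rest Q : Q \subset S -> Y :\: Q = B :|: (S :\: Q).
Proof.
move=> QS; apply/setP => x; rewrite !inE.
case: (boolP (x \in S)) => [xS|xS] /=.
  by rewrite (subsetP SY) // andbT.
rewrite andbF orbF; case: (boolP (x \in Q)) => //= xQ.
by rewrite (subsetP QS) in xS.
Qed.

Lemma conn_rest Q : Q \subset S ->
  (forall X, closed_in (adj G) (S :\: Q) X -> X != set0 ->
     linked (adj G) X B) ->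
  conn (adj G) (Y :\: Q).
Proof.
by move=> QS H; rewrite setD_rest //; apply: conn_attach => //; exact: adj_sym.
Qed.

Lemma conn_rest_all Q : Q \subset S ->
  (forall x, x \in S -> x \notin Q -> linked (adj G) [set x] B) ->
  conn (adj G) (Y :\: Q).
Proof.
move=> QS H; apply: conn_rest => // X /closed_inP[XS _] /set0Pn[x xX].
have := subsetP XS x xX; rewrite inE => /andP[xQ xS].
by apply: linked_sub (subxx _) (H x xS xQ); rewrite sub1set.
Qed.

(** What remains of [S] hangs on [r], and [r] is attached to [B]. *)
Lemma conn_complement X : closed_in (adj G) S' X -> conn (adj G) (Y :\: X).
Proof.
move=> cX; have [XS _] := closed_inP _ _ _ cX.
have XS0 : X \subset S := subset_trans XS (subsetDl _ _).
have -> : Y :\: X = (B :|: [set r]) :|: (S' :\: X).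
  rewrite setD_rest // -setUA; congr (_ :|: _); apply/setP => x; rewrite !inE.
  have [->|_] := eqVneq x r; last by [].
  by rewrite rS andbT; apply/negP => /(subsetP XS); rewrite !inE eqxx.
apply: (conn_attach (@adj_sym _ _ G)).
  have [->|/r_linked rB] := eqVneq B set0; first by rewrite set0U conn1.
  apply: (conn_attach (@adj_sym _ _ G)) => // Z /closed_inP[].
  by rewrite subset1 => /orP[/eqP->//|/eqP->]; rewrite eqxx.
move=> Z cZ Z0; apply: linked_sub (subxx _) (subsetUr _ _) _.
apply: linked_root => //; apply: closed_in_trans cZ.
exact: (closed_inD (@adj_sym _ _ G) cX).
Qed.

Lemma surplus_glue_root X1 X2 s1 s2 : closed_in (adj G) S' X1 ->
  X2 \subset S' -> [disjoint X1 & X2] ->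
  surplus (r |: X1) s1 -> surplus (r |: X2) s2 ->
  surplus (r |: (X1 :|: X2)) (s1 + s2 + hh).
Proof.
move=> cX1 X2S dX sX1 sX2; have [X1S _] := closed_inP _ _ _ cX1.
have r1 : r \notin X1 by apply/negP => /(subsetP X1S); rewrite !inE eqxx.
have r2 : r \notin X2 by apply/negP => /(subsetP X2S); rewrite !inE eqxx.
rewrite setUUr; apply: (surplus_glue (r := r)) => //.
  by rewrite -setUIr disjoint_setI0 // setU0.
rewrite !setU1K //; exact: closed_in_unlinked cX1 X2S dX.
Qed.

(** Components are peeled off and glued back at [r]. The term - hh reproduces itself because each
    gluing earns [hh]. *)
Lemma surplus_pieces : (forall C, closed_in (adj G) S' C -> C != set0 ->
    conn (adj G) C -> surplus (r |: C) (eps / 3 * #|C|%:R - hh)) ->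
  forall X, closed_in (adj G) S' X ->
    surplus (r |: X) (eps / 3 * #|X|%:R - hh).
Proof.
move=> H X; have [n] := ubnP #|X|; elim: n X => // n IHn X Xn cX.
have [->|X0] := eqVneq X set0.
  by rewrite setU0 cards0 mulr0 add0r; exact: surplus1.
have [C [cC CX C0 connC]] := minimal_closed_in cX X0.
have cD : closed_in (adj G) S' (X :\: C).
  apply: (closed_in_trans cX (closed_inD (@adj_sym _ _ G) _)).
  by apply: (closed_in_sub cC _ CX); case/closed_inP: cX.
have cXC : #|X| = (#|C| + #|X :\: C|)%N by rewrite -(cardsID C X) (setIidPr CX).
have CXE : C :|: (X :\: C) = X by rewrite -{1}(setIidPr CX) setID.
have lt : (#|X :\: C| < n)%N.
  rewrite -ltnS; apply: leq_trans Xn.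
  by rewrite ltnS cXC -[ltnLHS]add0n ltn_add2r card_gt0.
have d : [disjoint C & X :\: C].
  by rewrite -setI_eq0 setIDA setIC setDIl setDv setI0.
have [XCS _] := closed_inP _ _ _ cD.
have := surplus_glue_root cC XCS d (H C cC C0 connC) (IHn _ lt cD).
rewrite CXE cXC natrD; apply: surplus_le; lra.
Qed.

(* The diamond S itself may have surplus 0 for lam = 1/3, so what is removed  *)
(* depends on which of its vertices are attached to B.                        *)
Lemma remove_diamond_tight u w y : lam = 1 / 3 -> S = [set r; u; w; y] ->
  triangle u w y -> adj G r u -> adj G r w -> ~~ adj G r y -> r != y ->
  linear_surplus Y.
Proof.
move=> l3 SE /and3P[uw wy uy] ru rw ry rny.
have hE : hh = 1 / 3 by rewrite l3; lra.
have eps3 : eps <= 1 / 3 by rewrite -hE.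
have sub4 (Q : {set V}) x1 x2 x3 : Q \subset [set x1; x2; x3] -> (#|Q| <= 4)%N.
  move=> /subset_leq_card/leq_trans; apply; rewrite -setUA.
  by rewrite !cardsU1 cards1; do 2!case: (_ \notin _).
(* If [S] is all of [Y], the disjoint edges [ru] and [wy] give surplus 0, enough for four
   vertices. *)
have [B0|B0] := eqVneq B set0.
  have YS : Y = S by apply/eqP; rewrite eqEsubset SY andbT -setD_eq0 B0.
  have d : [disjoint [set r; u] & [set w; y]].
    rewrite -setI_eq0; apply/eqP/setP => x; rewrite !inE; apply/negP.
    move=> /andP[/orP[]/eqP-> /orP[]]; apply/negP;
      rewrite ?(adj_neq rw) ?rny //.
      by rewrite adj_neq.
    by rewrite adj_neq.
  have := surplus_disjoint d (surplus2 ru) (surplus2 wy).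
  have -> : [set r; u] :|: [set w; y] = S by rewrite SE !setUA.
  rewrite -YS; apply: surplus_le.
  have -> : #|Y|%:R = 4 :> R.
    rewrite YS SE -!setUA !cardsU1 cards1 !inE !negb_or rny.
    by rewrite !adj_neq.
  by have := eps_gt0; nra.
have rB := r_linked B0.
(* If one of [u], [w] is attached to [B], it stays and the induced path r, a, y through the other
   one is removed. *)
have path3 a b : [set a; b] = [set u; w] -> linked (adj G) [set b] B ->
    adj G r a -> adj G a y -> linear_surplus Y.
  move=> ab bB ra ay.
  have QS : [set r; a; y] \subset S.
    rewrite SE; apply/subsetP => x; rewrite !inE -!orbA.
    have : a \in [set u; w] by rewrite -ab set21.
    rewrite !inE => aE /or3P[]/eqP->; rewrite ?eqxx ?orbT //.
    by case/orP: aE => ->; rewrite ?orbT.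
  have Q0 : [set r; a; y] != set0.
    by apply/set0Pn; exists y; rewrite !inE eqxx orbT.
  apply: remove_small (subset_trans QS SY) Q0 (sub4 _ _ _ _ (subxx _)) _
    (surplus_path ra ay ry rny) eps_le.
  apply: conn_rest_all => // x xS.
  rewrite !inE !negb_or => /andP[/andP[xr xa] xy].
  have : x \in [set a; b].
    by move: xS; rewrite ab SE !inE (negPf xr) (negPf xy) orbF.
  by rewrite !inE (negPf xa) => /eqP->.
case: (boolP (linked (adj G) [set w] B)) => [wB|wB]; first exact: (path3 u w).
case: (boolP (linked (adj G) [set u] B)) => [uB|uB].
  by apply: (path3 w u) => //; rewrite setUC.
have uwB : ~~ linked (adj G) [set u; w] B.
  apply/linkedP => -[x [z []]]; rewrite !inE => /orP[]/eqP-> zB xz.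
    by case/negP: uB; apply/linkedP; exists u, z; rewrite set11 inE.
  by case/negP: wB; apply/linkedP; exists w, z; rewrite set11 inE.
have BE (Q W : {set V}) : Q \subset S -> S \subset Q :|: W ->
    ~~ linked (adj G) Q B -> W \subset Y :\: Q ->
    edges_between G Q (Y :\: Q) = edges_between G Q W.
  move=> QS SQW nQB WY; apply: edges_between_restrict => //.
  apply: contra nQB; apply: linked_sub (subxx _) _.
  apply/subsetP => x; rewrite !inE => /andP[xW /andP[xQ ->]]; rewrite andbT.
  by apply: contra xW => /(subsetP SQW); rewrite inE (negPf xQ).
have neq : [/\ r != u, r != w, u != w, u != y & w != y] by rewrite !adj_neq.
have [nru nrw nuw nuy nwy] := neq.
(* Now neither [u] nor [w] is attached. If [y] is, the edge [uw] is removed: it sends four edges to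
   [r] and [y], and 4/3 rounds up to 2. *)
case: (boolP (linked (adj G) [set y] B)) => [yB|yB].
  have QS : [set u; w] \subset S.
    by rewrite SE; apply/subsetP => x; rewrite !inE => /orP[]->; rewrite !orbT.
  have Q0 : [set u; w] != set0 by apply/set0Pn; exists u; rewrite set21.
  have QWd : [disjoint [set u; w] & [set r; y]].
    rewrite -setI_eq0; apply/eqP/setP => x; rewrite !inE; apply/negP.
    move=> /andP[/orP[]/eqP-> /orP[]]; apply/negP => //; by rewrite eq_sym.
  have e4 : #|edges_between G [set u; w] (Y :\: [set u; w])| = 4%N.
    rewrite (BE _ [set r; y]) //.
    - rewrite card_edges_between // !big_set2 // ![adj G _ r]adj_sym.
      by rewrite ru rw uy wy.
    - by rewrite SE; apply/subsetP => x; rewrite !inE;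
         do !case: (_ == _).
    apply/subsetP => x xW; rewrite inE (disjointFl QWd xW) (subsetP SY) //.
    by move: xW; rewrite SE !inE => /orP[]->; rewrite ?orbT.
  apply: (remove_round (j := 2) (subset_trans QS SY) Q0 _ _ (surplus2 uw) e4).
  - by apply: (sub4 _ u w y); apply: subsetUl.
  - apply: conn_rest_all => // x; rewrite {1}SE !inE -!orbA negb_or.
    by move=> /or4P[]/eqP->; rewrite ?eqxx ?andbF.
  - by rewrite l3; lra.
  - by rewrite l3; lra.
(* Only [r] is attached: the triangle [uwy] has guaranteed surplus 0, and its two edges to [r] gain
   1 - 2/3. *)
have CS : [set u; w; y] \subset S.
  by rewrite SE; apply/subsetP => x; rewrite !inE; do !case: (_ == _).
have CE : [set u; w; y] = S'.
  apply/setP => x; rewrite SE !inE; have [->|//] := eqVneq x r.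
  by rewrite (negPf nru) (negPf nrw) (negPf rny).
have C0 : [set u; w; y] != set0 by apply/set0Pn; exists u; rewrite !inE eqxx.
have CrD : [disjoint [set u; w; y] & [set r]].
  by rewrite disjoint_sym disjoints1 CE !inE eqxx.
have e2 : #|edges_between G [set u; w; y] (Y :\: [set u; w; y])| = 2%N.
  rewrite (BE _ [set r]) //.
  - rewrite card_edges_between // -setUA big_setU1 ?inE ?negb_or ?nuw ?nuy //=.
    rewrite big_set2 // !big_set1 ![adj G _ r]adj_sym ru rw.
    by rewrite (negPf ry).
  - by rewrite CE setUC setD1K.
  - apply/linkedP => -[x [z []]]; rewrite inE => /orP[xuw zB xz|].
      by case/negP: uwB; apply/linkedP; exists x, z.
    by move=> xy zB xz; case/negP: yB; apply/linkedP; exists x, z.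
  by rewrite sub1set inE (disjointFl CrD) ?set11 // (subsetP SY).
have tri : triangle u w y by apply/and3P.
have j1 : 1%:R - 1 < lam * 2 by rewrite l3; lra.
apply: (remove_round (j := 1) (subset_trans CS SY) C0 _ _
  (surplus_triangle tri j1) e2).
- by apply: (sub4 _ u w y); exact: subxx.
- by apply: conn_complement; rewrite CE closed_in_refl.
- by rewrite l3; lra.
- by rewrite l3; lra.
Qed.

(** Split [S] into the edges [ra] and [bc]. Two, three or four edges cross, and rounding yields
    [eps] unless three edges cross at lam = 1/3, which is the diamond. *)
Lemma remove_triangle_root a b c : middle_lam -> S = [set r; a; b; c] ->
  triangle a b c -> adj G r a -> r != b -> r != c -> linear_surplus Y.
Proof.
move=> [l1 l2 epsm] SE abc ra rnb rnc; have /and3P[ab bc ac] := abc.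
have d : [disjoint [set r; a] & [set b; c]].
  rewrite -setI_eq0; apply/eqP/setP => x; rewrite !inE; apply/negP.
  by move=> /andP[/orP[]/eqP-> /orP[]]; apply/negP => //; exact: adj_neq.
have S0 : S != set0 by apply/set0Pn; exists r.
have S4 : (#|S| <= 4)%N.
  by rewrite SE -!setUA !cardsU1 cards1; do 3!case: (_ \notin _).
have SU : S = [set r; a] :|: [set b; c] by rewrite SE !setUA.
have ce : #|edges_between G [set r; a] [set b; c]| =
    (adj G r b + adj G r c + 2)%N.
  by rewrite card_edges_between // !big_set2 ?adj_neq // ab ac.
have fin (j e : nat) : (adj G r b + adj G r c + 2)%N = e ->
    j%:R - 1 < lam * e%:R -> eps <= j%:R - lam * e%:R -> linear_surplus Y.
  move=> ee je le; rewrite ee in ce.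
  have := surplus_round d ce je (surplus2 ra) (surplus2 bc).
  rewrite -SU => /(remove_small SY S0 S4 B_conn); apply.
  by lra.
case rb : (adj G r b); case rc : (adj G r c).
- by apply: (fin 2 4); rewrite ?rb ?rc //; lra.
- have [l3|l3] := eqVneq lam (1 / 3).
    by apply: (remove_diamond_tight l3 SE) => //; rewrite rc.
  have {}l3 : 1 / 3 < lam by rewrite lt_neqAle eq_sym l3.
  by apply: (fin 2 3); rewrite ?rb ?rc //; lra.
- have [l3|l3] := eqVneq lam (1 / 3).
    apply: (remove_diamond_tight (u := a) (w := c) (y := b) l3) => //.
    + by rewrite SE -!setUA [[set b] :|: _]setUC.
    + by rewrite /triangle ac ab adj_sym bc.
    + by rewrite rb.
  have {}l3 : 1 / 3 < lam by rewrite lt_neqAle eq_sym l3.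
  by apply: (fin 2 3); rewrite ?rb ?rc //; lra.
- by apply: (fin 1 2); rewrite ?rb ?rc //; lra.
Qed.

Definition component C :=
  [/\ closed_in (adj G) S' C, C != set0 & conn (adj G) C].

(** Both hypotheses are supplied by [linear_surplus_step], from the minimality of [S] and the
    absence of a three-vertex component of surplus [eps]. *)
Hypothesis component_card : forall C, component C -> (#|C| <= 3)%N.
Hypothesis component3 : forall C, component C -> #|C| = 3%N ->
  middle_lam /\ exists x y z, C = [set x; y; z] /\ triangle x y z.

Lemma component_notin C : closed_in (adj G) S' C -> r \notin C.
Proof.
by case/closed_inP=> CS _; apply/negP => /(subsetP CS); rewrite !inE eqxx.
Qed.

Lemma component3_root C : component C -> #|C| = 3%N ->
  middle_lam /\
  exists a b c, [/\ C = [set a; b; c], triangle a b c & adj G r a].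
Proof.
move=> compC C3; have [mid [x [y [z [CE xyz]]]]] := component3 compC C3.
split=> //; have [cC C0 _] := compC; have /and3P[xy yz xz] := xyz.
have /linkedP[a [b []]] := linked_root cC C0.
rewrite CE !inE -orbA => aC /eqP-> ar; rewrite adj_sym in ar.
case/or3P: aC ar => /eqP-> ar.
- by exists x, y, z.
- exists y, x, z; split=> //; first by rewrite [[set y; x]]setUC.
  by rewrite /triangle adj_sym xy xz yz.
- exists z, x, y; split=> //.
    by rewrite [RHS]setUC setUA setUC setUA setUC !setUA.
  by rewrite /triangle !(adj_sym G z) xy xz yz.
Qed.

Definition pendant_triangle C := exists a b,
  [/\ C = [set a; b], adj G a b, adj G r a & adj G r b].

(** With [r], a component of three vertices contains two disjoint edges covering everything, one of
    two vertices is a path or a triangle, and one vertex gives an edge. Only triangles in the middle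
    range escape. *)
Lemma component_cases C : component C ->
  surplus (r |: C) 0 \/ middle_lam /\ pendant_triangle C.
Proof.
move=> compC; have [cC C0 connC] := compC; have rC := component_notin cC.
have h0 : 0 <= hh by have [_ l1] := lam_bounds; lra.
have := component_card compC; rewrite leq_eqVlt => /orP[/eqP C3|].
  have [mid [a [b [c [CE /and3P[ab bc ac] ra]]]]] := component3_root compC C3.
  left; have d : [disjoint [set r; a] & [set b; c]].
    rewrite -setI_eq0; apply/eqP/setP => x; rewrite !inE; apply/negP.
    move: rC; rewrite CE !inE !negb_or => /andP[/andP[_ rb] rc].
    by move=> /andP[/orP[]/eqP-> /orP[]]; apply/negP => //; exact: adj_neq.
  have := surplus_disjoint d (surplus2 ra) (surplus2 bc).
  by rewrite CE !setUA addr0.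
have /linkedP[x [r' []]] := linked_root cC C0.
rewrite inE => xC /eqP-> {r'}; rewrite adj_sym => rx.
rewrite ltnS leq_eqVlt => /orP[/eqP C2|]; last first.
  rewrite ltnS leq_eqVlt ltnS leqn0 cards_eq0 (negPf C0) orbF => /cards1P[y CE].
  by left; move: xC; rewrite CE inE => /eqP <-; exact: surplus2.
have [a [b [CE ab]]] := conn_card2 connC C2.
have {CE ab} [y [CE xy]] : exists y, C = [set x; y] /\ adj G x y.
  move: xC; rewrite CE !inE => /orP[]/eqP->; first by exists b.
  by exists a; rewrite setUC adj_sym.
have ry' : r != y by move: rC; rewrite CE !inE negb_or => /andP[].
case: (boolP (adj G r y)) => ry; last first.
  left; rewrite CE setUA; apply: surplus_le (surplus_path rx xy ry ry') => //.
case: two_cases => [rich|mid]; last by right; split=> //; exists x, y.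
left; rewrite CE setUA; apply: surplus_le (ltW eps_gt0) _.
by apply: rich; rewrite /triangle rx xy.
Qed.

(** As |C| <= 3, the required term is at most eps - hh <= 0; a triangle with [r] has 1 - 2 lam - hh
    >= eps - hh. *)
Lemma component_surplus C : component C ->
  surplus (r |: C) (eps / 3 * #|C|%:R - hh).
Proof.
move=> compC; have C3 : #|C|%:R <= 3 :> R.
  by rewrite (ler_nat R _ 3); exact: component_card.
have le : eps / 3 * #|C|%:R <= eps by have := eps_gt0; nra.
have [sC|[[l1 l2 epsm] [a [b [CE ab ra rb]]]]] := component_cases compC.
  apply: surplus_le sC; rewrite subr_le0; exact: le_trans le eps_le.
have tri : triangle r a b by rewrite /triangle ra ab.
have j1 : 1%:R - 1 < lam * 2 by have [] := lam_bounds; lra.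
have := surplus_triangle tri j1; rewrite CE setUA; apply: surplus_le.
rewrite lerD2r -CE; apply: le_trans le _; lra.
Qed.

Lemma remove_rooted : linear_surplus Y.
Proof.
have S'0 : S' != set0.
  rewrite -card_gt0; move: S_card; rewrite (cardsD1 r) rS add1n.
  by rewrite ltnS; apply: leq_trans.
have S0 : S != set0 by apply/set0Pn; exists r.
have ccS : closed_in (adj G) S' S' by exact: closed_in_refl.
(* A single component has exactly three vertices, hence is a triangle. *)
have [[C [compC CE]]|nE] := pselect (exists C, component C /\ C = S').
  have C3 : #|C| = 3%N.
    apply/eqP; rewrite eqn_leq component_card //= CE.
    by move: S_card; rewrite (cardsD1 r) rS.
  have [mid [a [b [c [CE' abc ra]]]]] := component3_root compC C3.
  have [cC _ _] := compC; have := component_notin cC.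
  rewrite CE' !inE !negb_or => /andP[/andP[_ rb] rc].
  apply: (remove_triangle_root mid _ abc ra) => //.
  by rewrite -(setD1K rS) -CE CE' !setUA.
have rest C : component C ->
    closed_in (adj G) S' (S' :\: C) /\ S' :\: C != set0.
  move=> compC; have [cC _ _] := compC; split.
    exact: (closed_inD (@adj_sym _ _ G)).
  rewrite setD_eq0; apply/negP => sub; apply: nE; exists C; split=> //.
  by apply/eqP; rewrite eqEsubset sub andbT; case/closed_inP: cC.
(* With X the other components, [S] has surplus eps / 3 |X|, and |S| <= 4 + |X| <= 5 |X|; all of [S]
   is removed. *)
have [[C [compC sC]]|nD] :=
    pselect (exists C, component C /\ surplus (r |: C) 0).
  have [cC C0 _] := compC; have [cX X0] := rest C compC.
  have [CS _] := closed_inP _ _ _ cC.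
  have [XS _] := closed_inP _ _ _ cX.
  have d : [disjoint C & S' :\: C].
    by rewrite -setI_eq0 setIDA setIC setDIl setDv setI0.
  have pieces : surplus (r |: (S' :\: C)) (eps / 3 * #|S' :\: C|%:R - hh).
    by apply: surplus_pieces cX => D *; apply: component_surplus; split.
  have := surplus_glue_root cC XS d sC pieces.
  have -> : r |: (C :|: S' :\: C) = S.
    by rewrite -{1}(setIidPr CS) setID setD1K.
  move=> sS; apply: (remove_set SY S0 B_conn sS).
  have cS : #|S|%:R = 1 + #|C|%:R + #|S' :\: C|%:R :> R.
    rewrite -addrA -natrD -{1}(setIidPr CS) cardsID -[1]/(1%:R) -natrD.
    by rewrite (cardsD1 r S) rS.
  have C3 : #|C|%:R <= 3 :> R.
    by rewrite (ler_nat R _ 3); exact: component_card.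
  have X1 : 1 <= #|S' :\: C|%:R :> R by rewrite (ler_nat R 1) card_gt0.
  by rewrite cS; have := eps_gt0; nra.
have bad C : component C -> middle_lam /\ pendant_triangle C.
  move=> compC; case: (component_cases compC) => // sC.
  by case: nD; exists C.
(* An edge [C] not attached to [B] sends exactly two edges to the rest, both to [r], gaining 1 - 2
   lam. *)
have [[C [compC nCB]]|linkB] :=
    pselect (exists C, component C /\ ~~ linked (adj G) C B).
  have [[l1 l2 epsm] [a [b [CE ab ra rb]]]] := bad C compC.
  have [cC C0 _] := compC; have rC := component_notin cC.
  have [CS _] := closed_inP _ _ _ cC.
  have CY : C \subset Y.
    by apply: subset_trans CS _; apply: subset_trans SY; exact: subsetDl.
  have C4 : (#|C| <= 4)%N by apply: leq_trans (component_card compC) _.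
  have sC : surplus C 0 by rewrite CE; exact: surplus2.
  have e2 : #|edges_between G C (Y :\: C)| = 2%N.
    rewrite (edges_between_restrict (W' := [set r])).
    - rewrite card_edges_between; last by rewrite disjoint_sym disjoints1.
      rewrite CE big_set2 ?adj_neq // !big_set1 ![adj G _ r]adj_sym.
      by rewrite ra rb.
    - by rewrite sub1set inE rC (subsetP SY).
    apply/linkedP => -[x [y [xC]]]; rewrite !inE => /and3P[yr yC yY] xy.
    have [yS|yS] := boolP (y \in S); last first.
      by case/negP: nCB; apply/linkedP; exists x, y; rewrite !inE yS.
    have [_ cC'] := closed_inP _ _ _ cC.
    by move: yC; rewrite (cC' x) // !inE yr.
  apply: (remove_round (j := 1) CY C0 C4 (conn_complement cC) sC e2).
    by have [] := lam_bounds; lra.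
  by lra.
have linkedB X : closed_in (adj G) S' X -> X != set0 -> linked (adj G) X B.
  move=> cX X0; have [C [cC CX C0 connC]] := minimal_closed_in cX X0.
  case: (boolP (linked (adj G) C B)) => [|nl]; first exact: linked_sub.
  by case: linkB; exists C; split.
(* Every component is now attached to [B]. The path p1, r, p2 through two of them is chosen so that
   the partners l1 and l2 have their own edges to [B]. *)
have pl C : component C -> exists p l,
    [/\ C = [set p; l], adj G r p & linked (adj G) [set l] B].
  move=> compC; have [_ [a [b [CE ab ra rb]]]] := bad C compC.
  have [cC C0 _] := compC; have /linkedP[x [y [xC yB xy]]] := linkedB C cC C0.
  move: xC; rewrite CE !inE => /orP[]/eqP xE.
    exists b, a; split=> //; first by rewrite setUC.
    by apply/linkedP; exists x, y; rewrite xE set11 -xE.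
  exists a, b; split=> //.
  by apply/linkedP; exists x, y; rewrite xE set11 -xE.
have [C1 [cC1 _ C10 connC1]] := minimal_closed_in ccS S'0.
have compC1 : component C1 by split.
have [cX X0] := rest C1 compC1.
have [C2 [cC2 C2X C20 connC2]] := minimal_closed_in cX X0.
have compC2 : component C2 by split.
have [p1 [l1 [C1E rp1 l1B]]] := pl C1 compC1.
have [p2 [l2 [C2E rp2 l2B]]] := pl C2 compC2.
have [C1S cC1'] := closed_inP _ _ _ cC1.
have [C2S cC2'] := closed_inP _ _ _ cC2.
have p1C : p1 \in C1 by rewrite C1E set21.
have p2C : p2 \in C2 by rewrite C2E set21.
have p2C1 : p2 \notin C1 by have := subsetP C2X p2 p2C; rewrite inE => /andP[].
have np : ~~ adj G p1 p2.
  by apply: contra p2C1 => p12; apply: (cC1' p1) => //; exact: (subsetP C2S).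
have pp : p1 != p2 by apply: contraNneq p2C1 => <-.
have p1r : adj G p1 r by rewrite adj_sym.
have QS : [set p1; r; p2] \subset S.
  apply/subsetP => x; rewrite !inE -!orbA => /or3P[]/eqP-> //.
    by have := subsetP C1S p1 p1C; rewrite inE => /andP[].
  by have := subsetP C2S p2 p2C; rewrite inE => /andP[].
have Q0 : [set p1; r; p2] != set0.
  by apply/set0Pn; exists p1; rewrite !inE eqxx.
have Q4 : (#|[set p1; r; p2]| <= 4)%N.
  by rewrite -setUA !cardsU1 cards1; do 2!case: (_ \notin _).
apply: (remove_small (subset_trans QS SY) Q0 Q4 _
  (surplus_path p1r rp2 np pp) eps_le).
(* A remaining piece contains l1 or l2, or else it is closed in S - r and so attached to [B]. *)
apply: conn_rest => // X /closed_inP[XS cX'] X0'.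
have [l1X|l1X] := boolP (l1 \in X).
  by apply: linked_sub l1B => //; rewrite sub1set.
have [l2X|l2X] := boolP (l2 \in X).
  by apply: linked_sub l2B => //; rewrite sub1set.
have XQ x : x \in X -> [/\ x != p1, x != r, x != p2 & x \in S].
  by move=> /(subsetP XS); rewrite !inE !negb_or => /andP[/andP[/andP[]]].
apply: linkedB => //; apply/closed_inP; split.
  by apply/subsetP => x /XQ[_ xr _ xS]; rewrite !inE xr.
move=> x y xX yS' xy; have [xp1 xr xp2 xS] := XQ x xX.
have xS' : x \in S' by rewrite !inE xr.
have yx : adj G y x by rewrite adj_sym.
have [yr yS] : y != r /\ y \in S by move: yS'; rewrite !inE => /andP.
have [yp1|yp1] := eqVneq y p1.
  have : x \in C1 by apply: (cC1' y) => //; rewrite yp1.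
  rewrite C1E !inE (negPf xp1) /= => /eqP xl.
  by rewrite -xl xX in l1X.
have [yp2|yp2] := eqVneq y p2.
  have : x \in C2 by apply: (cC2' y) => //; rewrite yp2.
  rewrite C2E !inE (negPf xp2) /= => /eqP xl.
  by rewrite -xl xX in l2X.
by apply: (cX' x) => //; rewrite !inE !negb_or yp1 yr yp2.
Qed.

End Rooted.

(** A component of S - r with at least four vertices, rooted at a neighbour of [r], would be a
    smaller admissible pair. One with three vertices is removed at once if its surplus reaches
    [eps], which leaves triangles in the middle range. *)
Lemma linear_surplus_step : (4 <= #|Y|)%N -> linear_surplus Y.
Proof.
move=> Y4; have [r0 r0Y] : exists x, x \in Y.
  by apply/set0Pn; rewrite -card_gt0; apply: leq_trans Y4.
pose adm (p : V * {set V}) :=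
  [&& p.1 \in p.2, p.2 \subset Y, conn (adj G) p.2, (4 <= #|p.2|)%N,
      conn (adj G) (Y :\: p.2) &
      (Y :\: p.2 != set0) ==> linked (adj G) [set p.1] (Y :\: p.2)].
have adm0 : adm (r0, Y).
  by rewrite /adm /= r0Y subxx Y_conn Y4 setDv conn0 eqxx.
case: (arg_minnP (fun p : V * {set V} => #|p.2|) adm0) => -[r S] /=.
move=> /and5P[/= rS SY cS S4 /andP[cB /implyP rB]] minS.
have compl C : component r S C -> conn (adj G) (Y :\: C).
  by case=> cC _ _; exact: (conn_complement rS SY cS cB rB cC).
have CSr C : component r S C -> C \subset S :\ r by case=> /closed_inP[].
have CY C : component r S C -> C \subset Y.
  move=> /CSr CS; apply: subset_trans CS (subset_trans _ SY).
  exact: subsetDl.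
have cards C : component r S C -> (#|C| <= 3)%N.
  move=> compC; rewrite leqNgt; apply/negP => C4.
  have [cC C0 connC] := compC.
  have /linkedP[x [y []]] := linked_root rS cS cC C0.
  rewrite inE => xC /eqP-> xr {y}.
  have admC : adm (x, C).
    rewrite /adm /= xC CY // connC C4 compl //=; apply/implyP => _.
    apply/linkedP; exists x, r; rewrite set11 inE xr (subsetP SY) // andbT.
    by split=> //; exact: component_notin cC.
  have := minS _ admC; rewrite /= leqNgt => /negP; apply.
  apply: leq_ltn_trans (subset_leq_card (CSr C compC)) _.
  by rewrite [ltnRHS](cardsD1 r) rS.
have [[C [compC [C3 sC]]]|nrem] := pselect
    (exists C, component r S C /\ #|C| = 3%N /\ surplus C eps).
  apply: (remove_small (CY C compC) _ _ (compl C compC) sC (lexx _)).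
    by rewrite -card_gt0 C3.
  by rewrite C3.
apply: (remove_rooted rS SY cS S4 cB rB cards) => C compC C3.
have [_ _ connC] := compC.
have [x [y [z [CE xy yz xz]]]] := conn_card3 connC C3.
have [axz|naxz] := boolP (adj G x z); last first.
  case: nrem; exists C; split=> //; split=> //; rewrite CE.
  by apply: surplus_le eps_le _; exact: surplus_path.
have tri : triangle x y z by apply/and3P.
case: two_cases => [rich|mid]; last by split=> //; exists x, y, z.
by case: nrem; exists C; split=> //; split=> //; rewrite CE; exact: rich.
Qed.

End Step.

Lemma linear_surplus_small Y : conn (adj G) Y -> (#|Y| <= 3)%N ->
  linear_surplus Y.
Proof.
move=> cY; rewrite /linear_surplus.
have [l0 l1] := lam_bounds; have := eps_gt0; have := eps_le => ele e0.
rewrite leq_eqVlt => /orP[/eqP Y3|].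
  rewrite Y3; have [x [y [z [-> xy yz xz]]]] := conn_card3 cY Y3.
  have [axz|naxz] := boolP (adj G x z); last first.
    by apply: surplus_le (surplus_path xy yz naxz xz); lra.
  have tri : triangle x y z by apply/and3P.
  case: two_cases => [/(_ _ _ _ tri)|[l2 l3 epsm]].
    by apply: surplus_le; lra.
  have j1 : 1%:R - 1 < lam * 2 by lra.
  by apply: surplus_le (surplus_triangle tri j1); lra.
rewrite ltnS leq_eqVlt => /orP[/eqP Y2|].
  rewrite Y2; have [x [y [-> xy]]] := conn_card2 cY Y2.
  by apply: surplus_le (surplus2 xy); lra.
rewrite ltnS leq_eqVlt ltnS leqn0 => /orP[/cards1P[x ->]|].
  by rewrite cards1; apply: surplus_le (surplus1 x); lra.
rewrite cards_eq0 => /eqP->; rewrite cards0.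
by apply: surplus_le surplus0; lra.
Qed.

Lemma linear_surplus_conn Y : conn (adj G) Y -> linear_surplus Y.
Proof.
have [n] := ubnP #|Y|; elim: n Y => // n IHn Y Yn cY.
have [Y3|Y4] := leqP #|Y| 3; first exact: linear_surplus_small.
apply: linear_surplus_step => // Z ZY; apply: IHn.
exact: leq_trans ZY _.
Qed.

End LinearSurplus.

(** The extra [hh] turns the vertex term |V| back into |V| - 1. *)
Lemma APT_yes_surplus s (k : nat) : surplus setT s -> k%:R <= s + hh ->
  APT_yes lam Pi G k.
Proof.
move=> [D [PD H]] ks; exists _, (induced (del_edges G D) setT).
split=> //.
  exists val; first exact: val_inj.
  by move=> x y /= /andP[-> ->]; rewrite andbT.
have sub : inner G setT :\: D \subset
    (fun E : {set {x | x \in [set: V]}} => val @: E) @: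
      edges (induced (del_edges G D) setT).
  apply/subsetP => E; rewrite inE => /andP[ED].
  case/edges_betweenP=> x [y [_ _ xy EE]].
  apply/imsetP; exists [set exist _ x (in_setT x); exist _ y (in_setT y)].
    by rewrite in_edges_between !inE /= xy -EE ED.
  by rewrite imsetU1 imset_set1 EE.
have le := leq_trans (subset_leq_card sub) (leq_imset_card _ _).
rewrite -(ler_nat R) in le; apply: le_trans le.
by move: H; rewrite cardsT; lra.
Qed.

End Surplus.

(** At lam = 1/3 the triangle surplus (1 - 3 lam) / 2 vanishes, and from there on 1 - 2 lam <= (1 -
    lam) / 2, as a choice of [eps] requires. *)
Lemma exists_linear_surplus : lam <> 1 / 2 \/ contains_K 3 GG Pi ->
  exists2 eps : R, 0 < eps & forall (V : finType) (G : lgraph L V) Y,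
    GG G -> conn (adj G) Y -> linear_surplus G eps Y.
Proof.
move=> l12; have /andP[l0 l1] := lam01.
have [l2|l2|l2] := ltrgtP lam (1 / 2).
- have [l3|l3] := ltrP lam (1 / 3).
    exists ((1 - 3 * lam) / 2) => [|V G Y GG_G]; first by lra.
    apply: linear_surplus_conn => //; [by lra..|left] => x y z tri.
    have j1 : 1%:R - 1 < lam * 2 by lra.
    by have := surplus_triangle GG_G tri j1; apply: surplus_le; lra.
  exists (1 - 2 * lam) => [|V G Y GG_G]; first by lra.
  by apply: linear_surplus_conn => //; [lra..|right].
- exists ((1 - lam) / 2) => [|V G Y GG_G]; first by lra.
  apply: linear_surplus_conn => //; [by lra..|left] => x y z tri.
  have j2 : 2%:R - 1 < lam * 2 by lra.
  by have := surplus_triangle GG_G tri j2; apply: surplus_le; lra.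
- exists ((1 - lam) / 2) => [|V G Y GG_G]; first by lra.
  apply: linear_surplus_conn => //; [by lra..|left] => x y z tri.
  case: l12 => // K3; have := surplus_triangle_in GG_G K3 l2 tri.
  by apply: surplus_le; lra.
Qed.

End Property.

(** * The kernel *)

Section Encoding.
Variable L : finType.

Definition rows (n : nat) (G : lgraph L 'I_n) : seq (alphabet L) :=
  flatten [seq newrow L ::
             [seq (inr (adj G i j, ori G i j, lab G i j) : alphabet L)
             | j <- enum 'I_n]
          | i <- enum 'I_n].

Lemma encodeE (n : nat) (G : lgraph L 'I_n) (k : nat) :
  encode G k = nseq k (tick L) ++ rows G.
Proof. by []. Qed.

Lemma rows_no_tick (n : nat) (G : lgraph L 'I_n) :
  all (predC1 (tick L)) (rows G).
Proof.
rewrite /rows; elim: (enum 'I_n) {1}(enum 'I_n) => [|i s IH] t //=.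
by rewrite all_cat IH andbT; elim: t.
Qed.

Lemma count_rows (n : nat) (G : lgraph L 'I_n) :
  count_mem (newrow L) (rows G) = n.
Proof.
rewrite /rows -[RHS](size_enum_ord n).
elim: (enum 'I_n) {1}(enum 'I_n) => [|i s IH] t //=.
by rewrite count_cat IH; elim: t.
Qed.

Lemma rows_neq0 (n : nat) (G : lgraph L 'I_n) : (0 < n)%N -> rows G != [::].
Proof.
by apply: contraTneq => H; have := count_rows G; rewrite H /= => <-.
Qed.

Lemma encode_K1 :
  encode (complete L 1) 0 = [:: newrow L; isolated_entry L].
Proof.
have E : enum 'I_1 = [:: ord0].
  by apply: (inj_map val_inj); rewrite val_enum_ord.
by rewrite /encode !E.
Qed.

Lemma connected_K1 : connected (complete L 1).
Proof. by split=> [|x y]; rewrite ?card_ord // !ord1. Qed.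

End Encoding.

Lemma yes_K1 (R : realType) (lam : R) (L : finType) (GG Pi : graph_family L) :
  inclusive GG Pi -> GG _ (complete L 1) -> APT_yes lam Pi (complete L 1) 0.
Proof.
move=> [K1 _] GK; exists 'I_1, (complete L 1); split.
- by exists id.
- by apply: K1 => //; exists id => //; exists id.
- have -> : edges (complete L 1) = set0.
    by apply: (@inner_le1 _ _ (complete L 1)); rewrite cardsT card_ord.
  by rewrite cards0 card_ord subrr !mulr0 !addr0.
Qed.

Theorem mainTheorem3 (R : realType) (lam : R) (L : finType)
    (GG Pi : graph_family L) :
  0 < lam < 1 ->
  subgraph_closed GG ->
  graph_property GG Pi ->
  strongly_extendible lam GG Pi ->
  lam <> 1 / 2 \/ contains_K 3 GG Pi ->
  exists f : nat -> nat,
    (exists C k0 : nat, forall k : nat, (k0 <= k)%N -> (f k <= C * k ^ 2)%N) /\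
    APT_has_kernel lam GG Pi f.
Proof.
move=> lam01 GG_sub Pi_prop Pi_ext l12.
have [eps eps0 lin] := exists_linear_surplus lam01 GG_sub Pi_prop Pi_ext l12.
have [N NE] : exists N : nat, 15 <= N%:R * eps.
  exists (Num.bound (15 / eps)); rewrite -ler_pdivrMr //.
  by apply/ltW/archi_boundP; rewrite divr_ge0 // ltW.
exists (fun k => (k.+1 * N.+1)%N); split.
  exists (2 * N.+1)%N, 1%N => k k1.
  rewrite mulnAC leq_mul2r /=; apply: leq_trans (_ : 2 * k <= _)%N.
    by rewrite mul2n -addnn -addn1 leq_add2l.
  by rewrite leq_mul2l /= -mulnn leq_pmull.
exists (kmachine L N), 5%N, 1%N => n G k [GG_G cG].
have n0 : (0 < n)%N by case: cG => + _; rewrite card_ord.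
have [t tle] := kmachine_correct N k (rows_no_tick G) (rows_neq0 G n0).
rewrite count_rows -encodeE => comp.
have t5 : (t <= 5 * size (encode G k) ^ 1 + 5)%N.
  by rewrite expn1; apply: leq_trans tle _; rewrite leq_add2r leq_mul2r orbT.
move: comp; case: ltnP => [small|large] comp.
  by exists n, G, k, t; split=> //; rewrite ?leqnn // ltnW.
rewrite -encode_K1 in comp.
have GK : GG _ (complete L 1).
  apply: GG_sub GG_G; exists (fun=> Ordinal n0).
    by move=> x y; rewrite !ord1.
  by move=> x y; rewrite /= !ord1 eqxx.
exists 1%N, (complete L 1), 0%N, t; split=> //; split.
  by split=> //; exact: connected_K1.
split=> _; first by apply: yes_K1 GK; case: Pi_ext.
have cT : conn (adj G) setT by have [_] := (connectedP G).1 cG.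
have := lin _ _ _ GG_G cT; rewrite /linear_surplus cardsT card_ord => sur.
apply: (APT_yes_surplus sur); rewrite subrK.
(* From n - 1 >= k N and N eps >= 15, the excess eps / 15 (n - 1) is at least k. *)
have : (k * N + 1 <= n)%N by apply: leq_trans large; rewrite mulSn mulnS; lia.
rewrite -(ler_nat R) natrD natrM => le.
have k0 : 0 <= k%:R :> R by [].
by nra.
Qed.
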